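(* Let $G$ be a uniform pro-$p$ group, $X$ a finite connected graph, $\alpha\colon S\to G$ a voltage assignment, and assume every derived graph $X_n$ is connected. Then the $\Lambda$-modules $\mathrm{Pic}_\infty$ and $J_\infty$ are $\Lambda$-torsion modules which do not contain any non-trivial pseudo-null $\Lambda$-submodules.
   Context: A uniform pro-$p$ group $G$ of dimension $l$ is a finitely generated pro-$p$ group topologically generated by $l$ elements such that, with $G_n=G^{p^n}$, each $G_{n+1}$ is normal in $G_n$ and $G_n/G_{n+1}\cong(\mathbb{Z}/p\mathbb{Z})^l$. Put $G^{(n)}=G/G_n$ and $\Lambda=\mathbb{Z}_p[[G]]$; this is a Noetherian domain with a skew field of fractions $\mathcal{Q}(G)$. Graphs may have multiple edges and loops. Choose an orientation of each edge of $X$; $S$ is the set of the chosen oriented edges, and a voltage assignment is a map $\alpha\colon S\to G$, extended to reversed edges by $\alpha(\bar e)=\alpha(e)^{-1}$. The derived graph $X_n$ has vertex set $V(X)\times G^{(n)}$ and, for each $e\in S$ from $v$ to $v'$ and $g\in G^{(n)}$, an edge joining $(v,g)$ and $(v',g\bar\alpha(e))$, where $\bar\alpha(e)$ is the image of $\alpha(e)$ in $G^{(n)}$. The group $G^{(n)}$ acts by left multiplication on the second coordinate. For a finite graph $Y$: $\mathrm{Div}(Y)$ is the free $\mathbb{Z}_p$-module on $V(Y)$ and $\mathrm{Div}^0(Y)$ the submodule of coefficient-sum-zero divisors. $\mathrm{Pr}(Y)$ is the $\mathbb{Z}_p$-span of the divisors $\delta(y)=\sum_{e}(y-w_e)$,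 with $e$ running over the edges at $y$ and $w_e$ the other endpoint of $e$. Set $\mathrm{Pic}(Y)=\mathrm{Div}(Y)/\mathrm{Pr}(Y)$ and $J(Y)=\mathrm{Div}^0(Y)/\mathrm{Pr}(Y)$. Define $\mathrm{Pic}_\infty=\varprojlim_n\mathrm{Pic}(X_n)$ and $J_\infty=\varprojlim_n J(X_n)$ as $\Lambda$-modules. A finitely generated $\Lambda$-module $M$ is torsion if $\dim_{\mathcal{Q}(G)}(\mathcal{Q}(G)\otimes_\Lambda M)=0$. It is pseudo-null if it is torsion and $\mathrm{Ext}^1_\Lambda(M,\Lambda)=0$.
   Formalization: The dimension l of G is assumed positive: for the trivial group (l = 0) Λ = Z_p and Pic_∞ = Pic(X) has Z_p-rank 1, so it is not torsion and the claim fails. *)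

(* Defs.v *)
From HB Require Import structures.
From mathcomp Require Import all_boot all_order all_algebra fingroup.
From mathcomp Require Import boolp classical_sets cardinality topology.
From mathcomp Require Import freeg.

Set Implicit Arguments.
Unset Strict Implicit.
Unset Printing Implicit Defensive.

Import GRing.Theory.
Import GroupScope.
Local Open Scope classical_set_scope.
Local Open Scope quotient_scope.
Local Notation qrepr := generic_quotient.repr.

HB.mixin Record isTopologicalGroup G & Topological G & monoid.Group G := {
  mulg_continuous : continuous (fun x : G * G => x.1 * x.2);
  invg_continuous : continuous (fun x : G => x^-1)
}.

#[short(type="topGroupType")]
HB.structure Definition TopologicalGroup :=
  {G of Topological G & monoid.Group G & isTopologicalGroup G}.

Definition subgroup (G : groupType) (H : set G) : Prop :=
  [/\ H 1, forall x y, H x -> H y -> H (x * y) & forall x, H x -> H x^-1].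

(* A profinite group is a compact Hausdorff group whose open subgroups form a
   base of neighbourhoods of the identity. *)
HB.mixin Record isProfinite G & TopologicalGroup G := {
  profinite_compact : compact [set: G];
  profinite_hausdorff : hausdorff_space G;
  profinite_base : forall A : set G, nbhs 1 A ->
    exists H : set G, [/\ subgroup H, open H & H `<=` A]
}.

#[short(type="profiniteGroupType")]
HB.structure Definition ProfiniteGroup :=
  {G of TopologicalGroup G & isProfinite G}.

Record openNormal (G : topGroupType) := OpenNormal {
  onset :> G -> Prop;
  onset_subgroup : subgroup onset;
  onset_normal : forall x y, onset x -> onset (x ^ y);
  onset_open : open (onset : set G) }.

Section Translations.
Variable G : topGroupType.

Lemma mull_continuous (a : G) : continuous (fun x : G => a * x).
Proof.
move=> x; apply: (@continuous_comp _ _ _ (fun x : G => (a, x))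
  (fun y : G * G => y.1 * y.2)).
  by apply: cvg_pair; [exact: cvg_cst | exact: cvg_id].
exact: mulg_continuous.
Qed.

Lemma mulr_continuous (a : G) : continuous (fun x : G => x * a).
Proof.
move=> x; apply: (@continuous_comp _ _ _ (fun x : G => (x, a))
  (fun y : G * G => y.1 * y.2)).
  by apply: cvg_pair; [exact: cvg_id | exact: cvg_cst].
exact: mulg_continuous.
Qed.

End Translations.

Section Quotient.
Variables (G : topGroupType) (U : openNormal G).

Let U1 : U 1. Proof. by case: (onset_subgroup U). Qed.
Let UM x y : U x -> U y -> U (x * y).
Proof. by case: (onset_subgroup U) => _ + _; apply. Qed.
Let UV x : U x -> U x^-1. Proof. by case: (onset_subgroup U) => _ _; apply. Qed.

(* quotg U is G/U; it is finite (a finGroupType) when G is profinite. *)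
Definition coseteq (x y : G) : bool := `[< U (x^-1 * y) >].

Lemma coseteq_equiv : equiv_class_of coseteq.
Proof.
split=> [x|x y|y x z].
- by apply/asboolP; rewrite mulVg.
- by apply/idP/idP => /asboolP /UV h; apply/asboolP; rewrite invgM invgK in h.
- move=> /asboolP h1 /asboolP h2; apply/asboolP.
  by have := UM h1 h2; rewrite -mulgA (mulgA y) mulgV mul1g.
Qed.

Canonical coseteq_equivRel := EquivRelPack coseteq_equiv.
Canonical coseteq_encModRel := defaultEncModRel coseteq.

Definition quotg := {eq_quot coseteq}.
HB.instance Definition _ : EqQuotient G coseteq quotg := EqQuotient.on quotg.
HB.instance Definition _ := Choice.on quotg.

Lemma quotgP x y : reflect (U (x^-1 * y)) (\pi_quotg x == \pi_quotg y).
Proof. by rewrite piE; exact: asboolP. Qed.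

Definition quotg_mul := lift_op2 quotg (fun x y : G => x * y).
Definition quotg_one := lift_cst quotg (1 : G).
Definition quotg_inv := lift_op1 quotg (fun x : G => x^-1).

Lemma quotg_pi1 : quotg_one = \pi_quotg 1.
Proof. by rewrite /quotg_one; unlock. Qed.

Lemma quotg_piM x y : \pi_quotg (x * y) = quotg_mul (\pi_quotg x) (\pi_quotg y).
Proof.
unlock quotg_mul; apply/eqP/quotgP.
have /quotgP hx : \pi_quotg x == \pi_quotg (qrepr (\pi_quotg x)) by rewrite reprK.
have /quotgP hy : \pi_quotg y == \pi_quotg (qrepr (\pi_quotg y)) by rewrite reprK.
set x' := qrepr _ in hx *; set y' := qrepr _ in hy *.
have := UM (onset_normal y hx) hy.
by rewrite conjgE !invgM !mulgA mulgK.
Qed.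

Lemma quotg_piV x : \pi_quotg x^-1 = quotg_inv (\pi_quotg x).
Proof.
unlock quotg_inv; apply/eqP/quotgP.
have /quotgP hx : \pi_quotg (qrepr (\pi_quotg x)) == \pi_quotg x by rewrite reprK.
have := onset_normal x^-1 hx.
by rewrite conjgE !invgK !mulgA mulgK.
Qed.

Lemma quotg_mulA : associative quotg_mul.
Proof.
by move=> a b c; rewrite -[a]reprK -[b]reprK -[c]reprK -!quotg_piM mulgA.
Qed.
Lemma quotg_mul1 : left_id quotg_one quotg_mul.
Proof. by move=> a; rewrite quotg_pi1 -[a]reprK -quotg_piM mul1g. Qed.
Lemma quotg_mulr1 : right_id quotg_one quotg_mul.
Proof. by move=> a; rewrite quotg_pi1 -[a]reprK -quotg_piM mulg1. Qed.
Lemma quotg_mulV : left_inverse quotg_one quotg_inv quotg_mul.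
Proof. by move=> a; rewrite quotg_pi1 -[a]reprK -quotg_piV -quotg_piM mulVg. Qed.
Lemma quotg_mulrV : right_inverse quotg_one quotg_inv quotg_mul.
Proof. by move=> a; rewrite quotg_pi1 -[a]reprK -quotg_piV -quotg_piM mulgV. Qed.

HB.instance Definition _ := isGroup.Build quotg
  quotg_mulA quotg_mul1 quotg_mulr1 quotg_mulV quotg_mulrV.

End Quotient.

Definition piq (G : topGroupType) (U : openNormal G) (x : G) : quotg U :=
  \pi_(quotg U) x.

Lemma piqM (G : topGroupType) (U : openNormal G) (x y : G) :
  piq U (x * y) = piq U x * piq U y.
Proof. exact: quotg_piM. Qed.

Section QuotientFinite.
Variables (G : profiniteGroupType) (U : openNormal G).

Lemma piq_fiber_open (a : quotg U) : open [set x | piq U x = a].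
Proof.
rewrite openE => x <-.
have hU : nbhs (x^-1 * x) (U : set G).
  rewrite mulVg; apply: open_nbhs_nbhs; split; first exact: onset_open.
  by case: (onset_subgroup U).
have /(_ _ hU) := @mull_continuous G x^-1 x.
move=> h0; refine (@filterS G (nbhs x) _ _ _ _ h0) => y /= h.
by apply/esym/eqP; rewrite /piq; apply/quotgP.
Qed.

Lemma quotg_finite : exists s : seq (quotg U), forall a, a \in s.
Proof.
pose T : ptopologicalType :=
    HB.pack (G : Type) (Topological.class G) (isPointed.Build G 1).
have : @cover_compact T [set: T].
  by rewrite -compact_cover; exact: profinite_compact.
case/(_ (quotg U) setT (fun a => [set x | piq U x = a])).
- by move=> a _; exact: piq_fiber_open.
- by move=> x _; exists (piq U x).
- move=> D _ h; exists (finmap.enum_fset D) => a.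
  have [b bD /= hb] := h (qrepr a) I.
  by rewrite -[a]reprK -[\pi _]/(piq U _) hb.
Qed.

Definition quotg_enum : seq (quotg U) := undup (sval (cid quotg_finite)).

Lemma mem_quotg_enum a : a \in quotg_enum.
Proof. by rewrite mem_undup; exact: (svalP (cid quotg_finite)). Qed.

Lemma quotg_enumP : Finite.axiom quotg_enum.
Proof.
apply: Finite.uniq_enumP; first exact: undup_uniq.
by move=> a; rewrite mem_quotg_enum.
Qed.

Lemma quotg_pickleK : pcancel (index^~ quotg_enum) (onth quotg_enum).
Proof.
move=> a; have h : (index a quotg_enum < size quotg_enum)%N.
  by rewrite index_mem mem_quotg_enum.
by rewrite onthE (nth_map a) // nth_index // mem_quotg_enum.
Qed.

HB.instance Definition _ := isCountable.Build (quotg U) quotg_pickleK.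
HB.instance Definition _ := isFinite.Build (quotg U) quotg_enumP.
End QuotientFinite.

Definition quotmap (G : topGroupType) (U V : openNormal G) (a : quotg U) :
  quotg V := piq V (qrepr a).

Lemma quotmap_pi (G : topGroupType) (U V : openNormal G) (x : G) :
  (forall y, U y -> V y) -> quotmap V (piq U x) = piq V x.
Proof.
move=> UV; apply/eqP/quotgP/UV.
have /quotgP // : \pi_(quotg U) (qrepr (piq U x)) == \pi_(quotg U) x.
by rewrite reprK.
Qed.

Lemma quotmapM (G : topGroupType) (U V : openNormal G) :
  (forall y, U y -> V y) ->
  forall a b : quotg U, quotmap V (a * b) = quotmap V a * quotmap V b.
Proof.
move=> UV a b; rewrite -[a]reprK -[b]reprK -![\pi _]/(piq U _).
by rewrite -piqM !quotmap_pi // piqM.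
Qed.

(* The closed subgroup generated by A. *)
Definition topgen (G : topGroupType) (A : set G) : set G :=
  [set x | forall H : set G, subgroup H -> closed H -> A `<=` H -> H x].

(* G^(p^n), as a closed subgroup.  In a finitely generated pro-p group the
   abstract subgroup generated by the p^n-th powers is already closed. *)
Definition powg (G : topGroupType) (p n : nat) : set G :=
  topgen [set x ^+ (p ^ n)%N | x in [set: G]].
Arguments powg G p n : clear implicits.

(* H/K is isomorphic to A: a surjective morphism from H to A with kernel K. *)
Definition quot_iso (G : groupType) (H K : set G) (A : zmodType) : Prop :=
  exists phi : G -> A,
    [/\ forall x y, H x -> H y -> phi (x * y) = (phi x + phi y)%R,
        forall a, exists2 x, H x & phi x = a
      & forall x, H x -> (phi x = 0%R <-> K x)].

(* uniform_index says that the profinite group G is pro-p. *)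
Record uniform_pro_p (p l : nat) (G : profiniteGroupType) : Prop := UniformProP {
  uniform_prime : prime p;
  uniform_index : forall U : openNormal G, exists k, #|{: quotg U}| = (p ^ k)%N;
  uniform_gen : exists g : 'I_l -> G, topgen (range g) = [set: G];
  uniform_normal : forall n x y, powg G p n.+1 x -> powg G p n y ->
    powg G p n.+1 (x ^ y);
  uniform_quot : forall n,
    quot_iso (powg G p n) (powg G p n.+1) 'rV['F_p]_l }.

Section PowerSubgroups.
Variable G : topGroupType.
Implicit Types (A H : set G).

Lemma subset_topgen A : A `<=` topgen A.
Proof. by move=> x Ax H _ _; apply. Qed.

Lemma topgen_subgroup A : subgroup (topgen A).
Proof.
split=> [H|x y hx hy H|x hx H] sH cH AH.
- by case: sH.
- by have [_ + _] := sH; apply; [apply: hx|apply: hy].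
- by have [_ _] := sH; apply; apply: hx.
Qed.

Lemma topgen_closed A : closed (topgen A).
Proof.
have -> : topgen A = \bigcap_(H in [set H | [/\ subgroup H, closed H & A `<=` H]]) H.
  apply/seteqP; split=> [x h H [] |x h H ? ? ?]; first exact: h.
  exact: (h H).
by apply: closed_bigI => H [].
Qed.

Lemma conjg_continuous (a : G) : continuous (fun x : G => x ^ a).
Proof.
move=> x; rewrite [X in continuous_at _ X](_ : _ =
    (fun z => a^-1 * z) \o (fun z => z * a)).
  apply: continuous_comp; [exact: mulr_continuous | exact: mull_continuous].
by apply/funext => z; rewrite conjgE /= mulgA.
Qed.

Lemma topgen_normal A : (forall x y, A x -> A (x ^ y)) ->
  forall x y, topgen A x -> topgen A (x ^ y).
Proof.
move=> AJ x y h H sH cH AH.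
apply: (h [set z | H (z ^ y)]) => [| |z Az]; last exact/AH/AJ.
  case: sH => H1 HM HV; split=> [|u v Hu Hv|u Hu] /=.
  - by rewrite conj1g.
  - by rewrite conjMg; exact: HM.
  - by rewrite conjVg; exact: HV.
exact: (continuous_closedP _).1 (conjg_continuous (a := y)) _ cH.
Qed.

Lemma powg_normal p n x y : powg G p n x -> powg G p n (x ^ y : G).
Proof.
apply: topgen_normal => _ z [u _ <-].
by exists (u ^ z) => //; rewrite conjXg.
Qed.

Lemma powgS p m n : (m <= n)%N -> powg G p n `<=` (powg G p m : set G).
Proof.
move=> mn x h H sH cH AH; apply: (h H sH cH) => _ [z _ <-].
apply: AH; exists (z ^+ (p ^ (n - m))) => //.
by rewrite -expgM -expnD subnK.
Qed.

Lemma powg0 p : powg G p 0 = [set: G].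
Proof.
apply/seteqP; split=> // x _; apply: subset_topgen.
by exists x => //; rewrite expn0 expg1.
Qed.

End PowerSubgroups.

Section UniformFiltration.
Variables (p l : nat) (G : profiniteGroupType) (uG : uniform_pro_p p l G).

Lemma powg_open n : open (powg G p n : set G).
Proof.
elim: n => [|n IHn]; first by rewrite powg0; exact: openT.
have [phi [phiM phiS phiK]] := uniform_quot uG n.
have [G1 M_n V_n] : subgroup (powg G p n) by exact: topgen_subgroup.
have sub : powg G p n.+1 `<=` (powg G p n : set G) by apply: powgS.
have closedC v : v != 0%R -> closed [set z : G | powg G p n z /\ phi z = v].
  move=> _; have [x xG xv] := phiS v.
  rewrite (_ : [set z | _] = (fun z => x^-1 * z) @^-1` powg G p n.+1).
    apply: (continuous_closedP _).1; [exact: mull_continuous | exact: topgen_closed].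
  have phi1 : phi 1 = 0%R.
    have := phiM _ _ G1 G1; rewrite mulg1 => /eqP.
    by rewrite -subr_eq0 opprD addNKr oppr_eq0 => /eqP.
  have phiV : phi x^-1 = (- v)%R.
    have := phiM _ _ xG (V_n _ xG); rewrite mulgV phi1 xv => /eqP.
    by rewrite eq_sym addrC addr_eq0 => /eqP.
  apply/seteqP; split=> [z [zG zv]|z /= h] /=.
    apply/phiK; first by apply: M_n => //; exact: V_n.
    by rewrite phiM //; [rewrite phiV zv addNr | exact: V_n].
  have zG : powg G p n z by rewrite -(mulKVg x z); apply: M_n => //; exact: sub.
  split=> //; have /phiK := h; rewrite phiM //; last exact: V_n.
  move=> /(_ (sub _ h)) /eqP; rewrite phiV addrC subr_eq0.
  by move/eqP.
rewrite openE => x hx; rewrite /interior /=.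
have near_n : nbhs x (powg G p n : set G).
  by apply: open_nbhs_nbhs; split => //; exact: sub.
have near_v : \forall z \near x, forall v : 'rV['F_p]_l,
    v != 0%R -> ~ (powg G p n z /\ phi z = v).
  apply: filter_forall => v; have [->|v0] := eqVneq v 0%R; first exact: nearW.
  suff : nbhs x (~` [set z : G | powg G p n z /\ phi z = v]).
    by apply: filterS => z h _.
  apply: open_nbhs_nbhs; split; first exact/closed_openC/closedC.
  by move=> [_ xv]; move: v0; rewrite -xv (phiK x (sub _ hx)).2 // eqxx.
near=> z; have zG : powg G p n z by near: z.
apply/phiK => //; apply/eqP; apply: contrapT => /negP v0.
have hz : forall v : 'rV['F_p]_l, v != 0%R -> ~ (powg G p n z /\ phi z = v).
  by near: z.
exact: (hz _ v0 (conj zG erefl)).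
Unshelve. all: by end_near. Qed.

Definition Gn (n : nat) : openNormal G :=
  @OpenNormal G (powg G p n) (topgen_subgroup _)
    (fun x y => @powg_normal G p n x y) (powg_open n).

End UniformFiltration.

Local Close Scope group_scope.
Local Open Scope ring_scope.

Section InverseLimitRing.
Variables (I : Type) (le : I -> I -> Prop) (R : I -> pzRingType).
Variable tr : forall i j, le i j -> {rmorphism R j -> R i}.

Record limring := LimRing {
  limr :> forall i, R i;
  limrP : forall i j (h : le i j), tr h (limr j) = limr i }.

Lemma limr_inj (x y : limring) : (forall i, x i = y i) -> x = y.
Proof.
case: x y => [x hx] [y hy] /= h.
have xy : x = y by apply: functional_extensionality_dep.
move: hx hy; rewrite xy => hx hy; congr LimRing; exact: Prop_irrelevance.
Qed.

HB.instance Definition _ := gen_eqMixin limring.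
HB.instance Definition _ := gen_choiceMixin limring.

Definition limr0 : limring := @LimRing (fun i => 0) (fun i j h => rmorph0 _).
Definition limr1 : limring := @LimRing (fun i => 1) (fun i j h => rmorph1 _).

Fact limrN_subproof (x : limring) i j (h : le i j) : tr h (- x j) = - x i.
Proof. by rewrite rmorphN limrP. Qed.
Definition limrN (x : limring) : limring := LimRing (limrN_subproof x).

Fact limrD_subproof (x y : limring) i j (h : le i j) :
  tr h (x j + y j) = x i + y i.
Proof. by rewrite rmorphD !limrP. Qed.
Definition limrD (x y : limring) : limring := LimRing (limrD_subproof x y).

Fact limrM_subproof (x y : limring) i j (h : le i j) :
  tr h (x j * y j) = x i * y i.
Proof. by rewrite rmorphM !limrP. Qed.
Definition limrM (x y : limring) : limring := LimRing (limrM_subproof x y).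

Fact limr_addA : associative limrD.
Proof. by move=> x y z; apply: limr_inj => i /=; rewrite addrA. Qed.
Fact limr_addC : commutative limrD.
Proof. by move=> x y; apply: limr_inj => i /=; rewrite addrC. Qed.
Fact limr_add0 : left_id limr0 limrD.
Proof. by move=> x; apply: limr_inj => i /=; rewrite add0r. Qed.
Fact limr_addN : left_inverse limr0 limrN limrD.
Proof. by move=> x; apply: limr_inj => i /=; rewrite addNr. Qed.
Fact limr_mulA : associative limrM.
Proof. by move=> x y z; apply: limr_inj => i /=; rewrite mulrA. Qed.
Fact limr_mul1 : left_id limr1 limrM.
Proof. by move=> x; apply: limr_inj => i /=; rewrite mul1r. Qed.
Fact limr_mulr1 : right_id limr1 limrM.
Proof. by move=> x; apply: limr_inj => i /=; rewrite mulr1. Qed.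
Fact limr_mulDl : left_distributive limrM limrD.
Proof. by move=> x y z; apply: limr_inj => i /=; rewrite mulrDl. Qed.
Fact limr_mulDr : right_distributive limrM limrD.
Proof. by move=> x y z; apply: limr_inj => i /=; rewrite mulrDr. Qed.

HB.instance Definition _ := GRing.isZmodule.Build limring
  limr_addA limr_addC limr_add0 limr_addN.
HB.instance Definition _ := GRing.Zmodule_isPzRing.Build limring
  limr_mulA limr_mul1 limr_mulr1 limr_mulDl limr_mulDr.

Definition limr_proj (i : I) (x : limring) : R i := x i.

Fact limr_proj_additive i : zmod_morphism (limr_proj i). Proof. by []. Qed.
Fact limr_proj_multiplicative i : monoid_morphism (limr_proj i).
Proof. by []. Qed.
HB.instance Definition _ i :=
  GRing.isZmodMorphism.Build limring (R i) (limr_proj i) (limr_proj_additive i).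
HB.instance Definition _ i := GRing.isMonoidMorphism.Build limring (R i)
  (limr_proj i) (limr_proj_multiplicative i).

End InverseLimitRing.

(* Z_p is the inverse limit of the Z/p^(k+1), k : nat. *)
Section PadicIntegers.
Variable p : nat.

Definition Zpk (k : nat) : comNzRingType := 'Z_(p ^ k.+1).

Definition Zpk_map (i j : nat) (x : Zpk j) : Zpk i := (x : nat)%:R.

Lemma Zpk_dvd i j : (i <= j)%N ->
  ((Zp_trunc (p ^ i.+1)).+2 %| (Zp_trunc (p ^ j.+1)).+2)%N.
Proof.
move=> ij; case: p => [|[|q]]; rewrite ?exp0n ?exp1n //.
have h k : (1 < q.+2 ^ k.+1)%N by rewrite -{1}(exp1n k.+1) ltn_exp2r.
by rewrite !Zp_cast ?h //; apply: dvdn_exp2l.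
Qed.

Lemma Zpk_natr i (n : nat) : val (n%:R : Zpk i) = (n %% (Zp_trunc (p ^ i.+1)).+2)%N.
Proof. by rewrite Zp_nat. Qed.

Lemma Zpk_map_nat i j (n : nat) : (i <= j)%N ->
  Zpk_map i (n%:R : Zpk j) = n%:R.
Proof.
move=> ij; apply/val_inj; rewrite /Zpk_map !Zpk_natr.
by rewrite modn_dvdm //; exact: Zpk_dvd.
Qed.

Lemma Zpk_natr_id j (x : Zpk j) : x = (x : nat)%:R.
Proof. by rewrite -[LHS]natr_Zp. Qed.

Lemma Zpk_mapD i j (x y : Zpk j) : (i <= j)%N ->
  Zpk_map i (x + y) = Zpk_map i x + Zpk_map i y.
Proof.
move=> ij; rewrite {1}(Zpk_natr_id x) {1}(Zpk_natr_id y) -natrD.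
by rewrite Zpk_map_nat // natrD.
Qed.

Lemma Zpk_mapM i j (x y : Zpk j) : (i <= j)%N ->
  Zpk_map i (x * y) = Zpk_map i x * Zpk_map i y.
Proof.
move=> ij; rewrite {1}(Zpk_natr_id x) {1}(Zpk_natr_id y) -natrM.
by rewrite Zpk_map_nat // natrM.
Qed.

Lemma Zpk_map_is_zmod_morphism i j : (i <= j)%N -> zmod_morphism (@Zpk_map i j).
Proof.
move=> ij x y; apply: (canRL (addrK _)).
by rewrite -Zpk_mapD // subrK.
Qed.

Lemma Zpk_map_is_monoid_morphism i j : (i <= j)%N ->
  monoid_morphism (@Zpk_map i j).
Proof.
move=> ij; split; first exact: (Zpk_map_nat 1).
by move=> x y; exact: Zpk_mapM.
Qed.

Definition Zpk_tr (i j : nat) (ij : (i <= j)%N) : {rmorphism Zpk j -> Zpk i} :=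
  HB.pack (@Zpk_map i j)
    (GRing.isZmodMorphism.Build _ _ _ (Zpk_map_is_zmod_morphism ij))
    (GRing.isMonoidMorphism.Build _ _ _ (Zpk_map_is_monoid_morphism ij)).

Definition padic : Type := limring Zpk_tr.
HB.instance Definition _ := GRing.PzRing.on padic.

Lemma padic_mulC : commutative (@GRing.mul padic).
Proof. by move=> x y; apply: limr_inj => i; exact: mulrC. Qed.
HB.instance Definition _ := GRing.PzRing_hasCommutativeMul.Build padic padic_mulC.

Lemma padic_oner_neq0 : (1 : padic) != 0.
Proof.
apply/eqP => /(congr1 (fun x : padic => limr x 0%N)) /= /eqP.
by rewrite oner_eq0.
Qed.
HB.instance Definition _ := GRing.PzSemiRing_isNonZero.Build padic padic_oner_neq0.

End PadicIntegers.

Section Pushforward.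
Variables (R : pzRingType) .

(* The linear map sending the basis element at s to the one at f s. *)
Definition fpush (S T : finType) (V : lmodType R) (f : S -> T)
    (a : {ffun S -> V}) : {ffun T -> V} :=
  [ffun t => \sum_(s | f s == t) a s].

Lemma fpush_is_linear (S T : finType) (V : lmodType R) (f : S -> T) :
  linear (@fpush S T V f).
Proof.
move=> c a b; apply/ffunP => t; rewrite !ffunE scaler_sumr -big_split /=.
by apply: eq_bigr => s _; rewrite !ffunE.
Qed.
HB.instance Definition _ S T V f :=
  GRing.isLinear.Build R _ _ _ (@fpush S T V f) (@fpush_is_linear S T V f).

Lemma fpush_comp (S T U : finType) (V : lmodType R) (f : S -> T) (g : T -> U)
    (a : {ffun S -> V}) : fpush g (fpush f a) = fpush (g \o f) a.
Proof.
apply/ffunP => u; rewrite !ffunE (partition_big f (fun t => g t == u)) //=.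
apply: eq_bigr => t /eqP gt; rewrite ffunE; apply: eq_bigl => s.
by have [->|_] := eqVneq (f s) t; rewrite ?gt ?eqxx ?andbT ?andbF.
Qed.

Lemma eq_fpush (S T : finType) (V : lmodType R) (f g : S -> T)
    (a : {ffun S -> V}) : f =1 g -> fpush f a = fpush g a.
Proof.
by move=> fg; apply/ffunP => t; rewrite !ffunE; apply: eq_bigl => s; rewrite fg.
Qed.

Lemma fpush_id (S : finType) (V : lmodType R) (a : {ffun S -> V}) :
  fpush id a = a.
Proof. by apply/ffunP => t; rewrite !ffunE big_pred1_eq. Qed.

Lemma sum_fpush (S T : finType) (V : lmodType R) (f : S -> T)
    (a : {ffun S -> V}) : \sum_t fpush f a t = \sum_s a s.
Proof.
rewrite [RHS](partition_big f predT) //=.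
by apply: eq_bigr => t _; rewrite ffunE.
Qed.

End Pushforward.

(* The group algebra R[H]: functions on H with the convolution product. *)
Definition galg (R : pzRingType) (H : finGroupType) : Type := {ffun H -> R^o}.

Section GroupAlgebra.
Variables (R : pzRingType) (H : finGroupType).
Local Notation A := (galg R H).
HB.instance Definition _ := GRing.Zmodule.copy A {ffun H -> R^o}.

Definition galg1 : A := [ffun x => (x == 1%g)%:R].
Definition galgM (a b : A) : A :=
  [ffun x => \sum_(y : H) (a y : R) * (b (y^-1 * x)%g : R)].

Fact galg_mulA : associative galgM.
Proof.
move=> a b c; apply/ffunP => x; rewrite !ffunE.
under eq_bigr => y _ do rewrite ffunE mulr_sumr.
under [RHS]eq_bigr => y _ do rewrite ffunE mulr_suml.
rewrite [RHS]exchange_big /=; apply: eq_bigr => y _.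
rewrite (reindex (fun z : H => y^-1 * z)%g) /=; last first.
  by apply: onW_bij; exists (fun z => y * z)%g => z; rewrite ?mulKg ?mulKVg.
by apply: eq_bigr => z _; rewrite mulrA invgM invgK -mulgA mulKVg.
Qed.

Fact galg_mul1 : left_id galg1 galgM.
Proof.
move=> a; apply/ffunP => x; rewrite !ffunE (bigD1 1%g) //= ffunE eqxx mul1r.
rewrite invg1 mul1g big1 ?addr0 // => y /negPf y1.
by rewrite ffunE y1 mul0r.
Qed.

Fact galg_mulr1 : right_id galg1 galgM.
Proof.
move=> a; apply/ffunP => x; rewrite !ffunE (bigD1 x) //= ffunE mulVg eqxx mulr1.
rewrite big1 ?addr0 // => y yx.
rewrite ffunE (_ : (_ == _) = false) ?mulr0 //.
by apply: contraNF yx => /eqP h; rewrite -(mulKVg y x) h mulg1.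
Qed.

Fact galg_mulDl : left_distributive galgM +%R.
Proof.
move=> a b c; apply/ffunP => x; rewrite !ffunE -big_split /=.
by apply: eq_bigr => y _; rewrite ffunE mulrDl.
Qed.

Fact galg_mulDr : right_distributive galgM +%R.
Proof.
move=> a b c; apply/ffunP => x; rewrite !ffunE -big_split /=.
by apply: eq_bigr => y _; rewrite ffunE mulrDr.
Qed.

HB.instance Definition _ := GRing.Zmodule_isPzRing.Build A
  galg_mulA galg_mul1 galg_mulr1 galg_mulDl galg_mulDr.

End GroupAlgebra.

Section GroupAlgebraMap.
Variables (R : pzRingType) (H K : finGroupType) (f : H -> K).
Hypothesis fM : forall x y, f (x * y)%g = (f x * f y)%g.

Definition galg_map (a : galg R H) : galg R K := fpush f a.

Fact galg_map_is_zmod_morphism : zmod_morphism galg_map.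
Proof. by move=> a b; exact: (linearB (@fpush R H K R^o f)). Qed.

Fact galg_map_is_monoid_morphism : monoid_morphism galg_map.
Proof.
have f1 : f 1%g = 1%g by apply: (mulgI (f 1%g)); rewrite -fM !mulg1.
have fV x : f x^-1%g = (f x)^-1%g by apply: (mulgI (f x)); rewrite -fM !mulgV.
split.
  apply/ffunP => k.
  rewrite !ffunE; have [->|k1] := eqVneq k 1%g.
    rewrite (bigD1 1%g) ?f1 //= ffunE eqxx big1 ?addr0 // => x /andP[_ /negPf x1].
    by rewrite ffunE x1.
  rewrite big1 // => x /eqP xk; rewrite ffunE (_ : (_ == _) = false) //.
  by apply: contraNF k1 => /eqP x1; rewrite -xk x1 f1.
move=> a b; apply/ffunP => k; rewrite !ffunE.
under eq_bigr => x _ do rewrite ffunE.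
rewrite exchange_big /=.
transitivity (\sum_y a y * galg_map b ((f y)^-1 * k)%g : R).
  apply: eq_bigr => y _; rewrite ffunE -mulr_sumr; congr (_ * _).
  rewrite (reindex (fun z : H => y * z)%g) /=; last first.
    by apply: onW_bij; exists (fun z => y^-1 * z)%g => z; rewrite ?mulKg ?mulKVg.
  apply: eq_big => z; last by rewrite mulKg.
  by rewrite fM -(inj_eq (mulgI (f y)^-1%g)) mulKg.
rewrite (partition_big f predT) //=; apply: eq_bigr => k' _.
by rewrite ffunE mulr_suml; apply: eq_bigr => y /eqP ->.
Qed.
End GroupAlgebraMap.

Section Submodules.
Variables (R : pzRingType) (V : lmodType R).

Definition submod (N : submodClosed V) : Type := {x : V | x \in N}.
HB.instance Definition _ (N : submodClosed V) :=
  SubChoice.copy (submod N) {x : V | x \in N}.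
HB.instance Definition _ (N : submodClosed V) :=
  [SubChoice_isSubLmodule of submod N by <:].

(* Membership in every submodule containing A. *)
Definition lspanp (A : set V) : pred V :=
  fun x => `[< forall N : submodClosed V, (forall a, A a -> a \in N) -> x \in N >].

Fact lspanp_closed (A : set V) : submod_closed (lspanp A).
Proof.
split=> [|c x y /asboolP hx /asboolP hy]; apply/asboolP => N AN.
  exact: rpred0.
by rewrite rpredD ?rpredZ ?hx ?hy.
Qed.

Definition lspan (A : set V) : submodClosed V :=
  HB.pack (lspanp A) (GRing.isSubmodClosed.Build R V (lspanp A) (lspanp_closed A)).

Lemma mem_lspan (A : set V) x : A x -> x \in lspan A.
Proof. by move=> Ax; apply/asboolP => N; apply. Qed.

Lemma lspan_sub (A : set V) (N : submodClosed V) :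
  (forall a, A a -> a \in N) -> {subset lspan A <= N}.
Proof. by move=> AN x /asboolP; apply. Qed.

End Submodules.

Section QuotientModule.
Variables (R : pzRingType) (V : lmodType R) (N : submodClosed V).

Let memN : V -> bool := fun x => x \in N.
Fact memN_zmod_closed : zmod_closed memN.
Proof.
split; first exact: rpred0.
by move=> x y hx hy; rewrite -topredE /= /memN -scaleN1r rpredD ?rpredZ.
Qed.

Definition zmodN : zmodClosed V :=
  HB.pack memN (GRing.isZmodClosed.Build V memN memN_zmod_closed).

Definition quotmod : Type := Quotient.quot zmodN.
HB.instance Definition _ := GRing.Zmodule.on quotmod.

Definition piN (x : V) : quotmod := \pi_(Quotient.quot zmodN) x.
Definition reprN (x : quotmod) : V := qrepr (x : Quotient.quot zmodN).

Lemma reprNK : cancel reprN piN. Proof. exact: reprK. Qed.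

Lemma piN_eq x y : (piN x == piN y) = (x - y \in N).
Proof. by symmetry; exact: (Quotient.idealrBE zmodN). Qed.

Fact piN_is_zmod_morphism : zmod_morphism piN.
Proof. by move=> x y; rewrite /piN !piE. Qed.
HB.instance Definition _ :=
  GRing.isZmodMorphism.Build V quotmod piN piN_is_zmod_morphism.

Definition quotmod_scale (c : R) (x : quotmod) : quotmod := piN (c *: reprN x).

Lemma piN_scale c x : piN (c *: x) = quotmod_scale c (piN x).
Proof.
apply/eqP; rewrite piN_eq -scalerBr rpredZ // -piN_eq; apply/eqP.
by rewrite reprNK.
Qed.

Fact quotmod_scaleA a b x :
  quotmod_scale a (quotmod_scale b x) = quotmod_scale (a * b) x.
Proof. by rewrite -(reprNK x) -!piN_scale scalerA. Qed.
Fact quotmod_scale1 : left_id 1 quotmod_scale.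
Proof. by move=> x; rewrite -(reprNK x) -piN_scale scale1r. Qed.
Fact quotmod_scaleDr : right_distributive quotmod_scale +%R.
Proof.
move=> a x y; rewrite -(reprNK x) -(reprNK y) -raddfD -!piN_scale.
by rewrite scalerDr raddfD.
Qed.
Fact quotmod_scaleDl x : {morph quotmod_scale^~ x : a b / a + b}.
Proof. by move=> a b; rewrite -(reprNK x) -!piN_scale scalerDl raddfD. Qed.

HB.instance Definition _ := GRing.Zmodule_isLmodule.Build R quotmod
  quotmod_scaleA quotmod_scale1 quotmod_scaleDr quotmod_scaleDl.

Fact piN_is_scalable : scalable piN. Proof. exact: piN_scale. Qed.
HB.instance Definition _ :=
  GRing.isScalable.Build R V quotmod *:%R piN piN_is_scalable.

End QuotientModule.

Section QuotientMap.
Variables (R : pzRingType) (V W : lmodType R).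
Variables (N : submodClosed V) (M : submodClosed W) (f : {linear V -> W}).
Hypothesis fN : forall x, x \in N -> f x \in M.

Definition quotmod_map (x : quotmod N) : quotmod M := piN M (f (reprN x)).

Lemma quotmod_map_pi x : quotmod_map (piN N x) = piN M (f x).
Proof.
by apply/eqP; rewrite piN_eq -linearB fN // -piN_eq reprNK.
Qed.

Lemma quotmod_map_is_linear : linear quotmod_map.
Proof.
move=> c x y; rewrite -(reprNK x) -(reprNK y) -linearP.
by rewrite !quotmod_map_pi !linearP.
Qed.

End QuotientMap.

Section GroupAction.
Variables (R : pzRingType) (H : finGroupType) (V : lmodType R).

Definition is_action (act : H -> {linear V -> V}) : Prop :=
  (forall x, act 1%g x = x)
  /\ (forall g h x, act (g * h)%g x = act g (act h x)).

Definition gmod (act : H -> {linear V -> V}) (actP : is_action act) : Type := V.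

Variables (act : H -> {linear V -> V}) (actP : is_action act).
Local Notation W := (gmod actP).
HB.instance Definition _ := GRing.Zmodule.on W.

Definition gmod_scale (a : galg R H) (x : V) : V :=
  \sum_h (a h : R) *: act h x.

Fact gmod_scaleA a b x :
  gmod_scale a (gmod_scale b x) = gmod_scale (a * b) x.
Proof.
rewrite /gmod_scale.
under eq_bigr => h _.
  rewrite linear_sum scaler_sumr.
  under eq_bigr => k _ do rewrite linearZ /= scalerA -actP.2.
  over.
under [RHS]eq_bigr => h _ do rewrite ffunE scaler_suml.
rewrite [RHS]exchange_big /=; apply: eq_bigr => h _.
rewrite [RHS](reindex (fun z : H => h * z)%g) /=; last first.
  by apply: onW_bij; exists (fun z => h^-1 * z)%g => z; rewrite ?mulKg ?mulKVg.
by apply: eq_bigr => k _; rewrite mulKg.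
Qed.

Fact gmod_scale1 : left_id 1 gmod_scale.
Proof.
move=> x; rewrite /gmod_scale (bigD1 1%g) //= ffunE eqxx scale1r.
rewrite actP.1 big1 ?addr0 // => h /negPf h1.
by rewrite ffunE h1 scale0r.
Qed.

Fact gmod_scaleDr : right_distributive gmod_scale +%R.
Proof.
move=> a x y; rewrite /gmod_scale -big_split; apply: eq_bigr => h _ /=.
by rewrite linearD scalerDr.
Qed.

Fact gmod_scaleDl x : {morph gmod_scale^~ x : a b / a + b}.
Proof.
move=> a b; rewrite /gmod_scale -big_split; apply: eq_bigr => h _ /=.
by rewrite ffunE scalerDl.
Qed.

HB.instance Definition _ := GRing.Zmodule_isLmodule.Build (galg R H) W
  gmod_scaleA gmod_scale1 gmod_scaleDr gmod_scaleDl.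

End GroupAction.

Section RestrictionOfScalars.
Variables (A B : pzRingType) (f : {rmorphism A -> B}) (V : lmodType B).

Definition restr (f : {rmorphism A -> B}) : Type := V.
HB.instance Definition _ := GRing.Zmodule.on (restr f).

Definition restr_scale (a : A) (x : restr f) : restr f := f a *: (x : V).

Fact restr_scaleA a b x : restr_scale a (restr_scale b x) = restr_scale (a * b) x.
Proof. by rewrite /restr_scale scalerA rmorphM. Qed.
Fact restr_scale1 : left_id 1 restr_scale.
Proof. by move=> x; rewrite /restr_scale rmorph1 scale1r. Qed.
Fact restr_scaleDr : right_distributive restr_scale +%R.
Proof. by move=> a x y; rewrite /restr_scale scalerDr. Qed.
Fact restr_scaleDl x : {morph restr_scale^~ x : a b / a + b}.
Proof. by move=> a b; rewrite /restr_scale rmorphD scalerDl. Qed.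

HB.instance Definition _ := GRing.Zmodule_isLmodule.Build A (restr f)
  restr_scaleA restr_scale1 restr_scaleDr restr_scaleDl.

End RestrictionOfScalars.

Section InverseLimitModule.
Variables (A : pzRingType) (I : Type) (le : I -> I -> Prop).
Variables (M : I -> lmodType A) (tr : forall i j, le i j -> {linear M j -> M i}).

Record limmod := LimMod {
  limm :> forall i, M i;
  limmP : forall i j (h : le i j), tr h (limm j) = limm i }.

Lemma limm_inj (x y : limmod) : (forall i, x i = y i) -> x = y.
Proof.
case: x y => [x hx] [y hy] /= h.
have xy : x = y by apply: functional_extensionality_dep.
move: hx hy; rewrite xy => hx hy; congr LimMod; exact: Prop_irrelevance.
Qed.

HB.instance Definition _ := gen_eqMixin limmod.
HB.instance Definition _ := gen_choiceMixin limmod.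

Definition limm0 : limmod := @LimMod (fun i => 0) (fun i j h => linear0 _).

Fact limmN_subproof (x : limmod) i j (h : le i j) : tr h (- x j) = - x i.
Proof. by rewrite linearN limmP. Qed.
Definition limmN (x : limmod) : limmod := LimMod (limmN_subproof x).

Fact limmD_subproof (x y : limmod) i j (h : le i j) :
  tr h (x j + y j) = x i + y i.
Proof. by rewrite linearD !limmP. Qed.
Definition limmD (x y : limmod) : limmod := LimMod (limmD_subproof x y).

Fact limmZ_subproof (a : A) (x : limmod) i j (h : le i j) :
  tr h (a *: x j) = a *: x i.
Proof. by rewrite linearZ /= limmP. Qed.
Definition limmZ (a : A) (x : limmod) : limmod := LimMod (limmZ_subproof a x).

Fact limm_addA : associative limmD.
Proof. by move=> x y z; apply: limm_inj => i /=; rewrite addrA. Qed.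
Fact limm_addC : commutative limmD.
Proof. by move=> x y; apply: limm_inj => i /=; rewrite addrC. Qed.
Fact limm_add0 : left_id limm0 limmD.
Proof. by move=> x; apply: limm_inj => i /=; rewrite add0r. Qed.
Fact limm_addN : left_inverse limm0 limmN limmD.
Proof. by move=> x; apply: limm_inj => i /=; rewrite addNr. Qed.

HB.instance Definition _ := GRing.isZmodule.Build limmod
  limm_addA limm_addC limm_add0 limm_addN.

Fact limm_scaleA a b x : limmZ a (limmZ b x) = limmZ (a * b) x.
Proof. by apply: limm_inj => i /=; rewrite scalerA. Qed.
Fact limm_scale1 : left_id 1 limmZ.
Proof. by move=> x; apply: limm_inj => i /=; rewrite scale1r. Qed.
Fact limm_scaleDr : right_distributive limmZ +%R.
Proof. by move=> a x y; apply: limm_inj => i /=; rewrite scalerDr. Qed.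
Fact limm_scaleDl x : {morph limmZ^~ x : a b / a + b}.
Proof. by move=> a b; apply: limm_inj => i /=; rewrite scalerDl. Qed.

HB.instance Definition _ := GRing.Zmodule_isLmodule.Build A limmod
  limm_scaleA limm_scale1 limm_scaleDr limm_scaleDl.

End InverseLimitModule.

(* Z_p[[G]] is the inverse limit of the Z_p[G/U], over all open normal U. *)
Section Iwasawa.
Variables (p : nat) (G : profiniteGroupType).

Definition on_le (V U : openNormal G) : Prop := forall y, U y -> V y.

Definition Lambda_tr (V U : openNormal G) (h : on_le V U) :
    {rmorphism galg (padic p) (quotg U) -> galg (padic p) (quotg V)} :=
  HB.pack (@galg_map (padic p) (quotg U) (quotg V) (quotmap V))
    (GRing.isZmodMorphism.Build _ _ _
      (@galg_map_is_zmod_morphism (padic p) (quotg U) (quotg V) (quotmap V)))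
    (GRing.isMonoidMorphism.Build _ _ _
      (@galg_map_is_monoid_morphism (padic p) (quotg U) (quotg V)
        (quotmap V) (quotmapM h))).

Definition Lambda : Type := limring Lambda_tr.
HB.instance Definition _ := GRing.PzRing.on Lambda.

Definition Lambda_proj (U : openNormal G) :
    {rmorphism Lambda -> galg (padic p) (quotg U)} :=
  limr_proj (tr := Lambda_tr) U.

End Iwasawa.

(* Multigraph with loops; an edge is stored once, with its chosen orientation
   from src to tgt, so edge X is the set S. *)
Record graph := Graph {
  vert : finType;
  edge : finType;
  src : edge -> vert;
  tgt : edge -> vert }.
Arguments src {g}.
Arguments tgt {g}.

Definition adjacent (Y : graph) (u v : vert Y) : bool :=
  [exists e : edge Y, ((src e == u) && (tgt e == v))
                   || ((src e == v) && (tgt e == u))].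

Definition connected_graph (Y : graph) : Prop :=
  inhabited (vert Y) /\ forall u v : vert Y, connect (@adjacent Y) u v.

Definition preimp (R : pzRingType) (V W : lmodType R) (f : {linear V -> W})
  (M : submodClosed W) : pred V := fun x => f x \in M.

Fact preimp_closed (R : pzRingType) (V W : lmodType R) (f : {linear V -> W})
  (M : submodClosed W) : submod_closed (preimp f M).
Proof.
split=> [|c x y]; rewrite -?topredE /= /preimp; first by rewrite linear0 rpred0.
by move=> hx hy; rewrite linearP rpredD ?rpredZ.
Qed.

Definition submod_preim (R : pzRingType) (V W : lmodType R) (f : {linear V -> W})
    (M : submodClosed W) : submodClosed V :=
  HB.pack (preimp f M)
    (GRing.isSubmodClosed.Build R V (preimp f M) (preimp_closed f M)).

Section Divisors.
Variables (p : nat) (Y : graph).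

Definition Div : lmodType (padic p) := {ffun vert Y -> (padic p)^o}.

Definition dirac (v : vert Y) : Div := [ffun w => (w == v)%:R].

(* The two sums run over the edges leaving and entering y; a loop at y occurs
   in both, with contribution 0. *)
Definition delta (y : vert Y) : Div :=
  \sum_(e : edge Y | src e == y) (dirac y - dirac (tgt e))
  + \sum_(e : edge Y | tgt e == y) (dirac y - dirac (src e)).

Definition Pr : submodClosed Div := lspan (range delta).

Definition deg0p : pred Div := fun D => \sum_v D v == 0.

Fact deg0p_closed : submod_closed deg0p.
Proof.
split=> [|c D E]; rewrite -?topredE /= /deg0p.
  by apply/eqP; apply: big1 => v _; rewrite ffunE.
move=> /eqP hD /eqP hE; apply/eqP.
transitivity (c *: (\sum_v D v) + \sum_v E v); last by rewrite hD hE scaler0 addr0.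
rewrite scaler_sumr -big_split; apply: eq_bigr => v _ /=.
by rewrite !ffunE.
Qed.

Definition Div0 : submodClosed Div :=
  HB.pack deg0p (GRing.isSubmodClosed.Build (padic p) Div deg0p deg0p_closed).

Definition Pic : lmodType (padic p) := quotmod Pr.

(* Pr viewed inside Div0 (it is contained in Div0). *)
Definition Pr0 : submodClosed (submod Div0) :=
  submod_preim (val : {linear submod Div0 -> Div}) Pr.

Definition J : lmodType (padic p) := quotmod Pr0.

End Divisors.

Section CoveringMaps.
Variable p : nat.

(* Vertex maps whose pushforward commutes with delta; they induce maps on Pic
   and J.  Used for the projections X_n -> X_m and for the left translations. *)
Record covmap (Y Z : graph) := CovMap {
  cov :> vert Y -> vert Z;
  covP : forall y, fpush cov (delta p y) = delta p (cov y) }.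

Section Maps.
Variables (Y Z : graph) (c : covmap Y Z).

Lemma fpush_Pr (D : Div p Y) : D \in Pr p Y -> fpush c D \in Pr p Z.
Proof.
move=> hD; apply: (@lspan_sub _ _ _ (submod_preim (fpush c) (Pr p Z)) _ D hD).
move=> _ [y _ <-].
rewrite -topredE /= /preimp /= covP.
by apply: mem_lspan; exists (c y).
Qed.

Lemma fpush_Div0 (D : Div p Y) : D \in Div0 p Y -> fpush c D \in Div0 p Z.
Proof. by rewrite -!topredE /= /deg0p sum_fpush. Qed.

Definition Pic_map : {linear Pic p Y -> Pic p Z} :=
  HB.pack (@quotmod_map _ _ _ (Pr p Y) (Pr p Z) (fpush c))
    (GRing.isLinear.Build _ _ _ _ _ (quotmod_map_is_linear fpush_Pr)).

Definition Div0_push (D : submod (Div0 p Y)) : submod (Div0 p Z) :=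
  Sub (fpush c (val D)) (fpush_Div0 (valP D)).

Fact Div0_push_is_linear : linear Div0_push.
Proof. by move=> a x y; apply: val_inj; rewrite /= !linearP. Qed.
HB.instance Definition _ :=
  GRing.isLinear.Build _ _ _ _ Div0_push Div0_push_is_linear.

Lemma Div0_push_Pr0 D : D \in Pr0 p Y -> Div0_push D \in Pr0 p Z.
Proof. exact: fpush_Pr. Qed.

Definition J_map : {linear J p Y -> J p Z} :=
  HB.pack (@quotmod_map _ _ _ (Pr0 p Y) (Pr0 p Z) Div0_push)
    (GRing.isLinear.Build _ _ _ _ _ (quotmod_map_is_linear Div0_push_Pr0)).

End Maps.

Lemma Pic_map_id (Y : graph) (c : covmap Y Y) (x : Pic p Y) :
  c =1 id -> Pic_map c x = x.
Proof.
move=> cid; rewrite -(reprNK x) /= (quotmod_map_pi (@fpush_Pr _ _ c)).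
by rewrite /= (eq_fpush _ cid) fpush_id.
Qed.

Lemma Pic_map_comp (Y1 Y2 Y3 : graph) (c : covmap Y1 Y2) (d : covmap Y2 Y3)
    (e : covmap Y1 Y3) (x : Pic p Y1) :
  e =1 d \o c -> Pic_map d (Pic_map c x) = Pic_map e x.
Proof.
move=> edc; rewrite -(reprNK x) /= (quotmod_map_pi (@fpush_Pr _ _ c)).
rewrite (quotmod_map_pi (@fpush_Pr _ _ d)) (quotmod_map_pi (@fpush_Pr _ _ e)).
by rewrite /= fpush_comp (eq_fpush _ edc).
Qed.

Lemma J_map_id (Y : graph) (c : covmap Y Y) (x : J p Y) :
  c =1 id -> J_map c x = x.
Proof.
move=> cid; rewrite -(reprNK x) /= (quotmod_map_pi (@Div0_push_Pr0 _ _ c)).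
congr piN; apply: val_inj.
by rewrite /= (eq_fpush _ cid) fpush_id.
Qed.

Lemma J_map_comp (Y1 Y2 Y3 : graph) (c : covmap Y1 Y2) (d : covmap Y2 Y3)
    (e : covmap Y1 Y3) (x : J p Y1) :
  e =1 d \o c -> J_map d (J_map c x) = J_map e x.
Proof.
move=> edc; rewrite -(reprNK x) /= (quotmod_map_pi (@Div0_push_Pr0 _ _ c)).
rewrite (quotmod_map_pi (@Div0_push_Pr0 _ _ d)).
rewrite (quotmod_map_pi (@Div0_push_Pr0 _ _ e)).
congr piN; apply: val_inj.
by rewrite /= fpush_comp (eq_fpush _ edc).
Qed.

End CoveringMaps.

Definition derived (X : graph) (H : finGroupType) (a : edge X -> H) : graph :=
  @Graph (vert X * H)%type (edge X * H)%type
    (fun e => (src e.1, e.2)) (fun e => (tgt e.1, (e.2 * a e.1)%g)).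

Lemma sum_pair_graph (E H : finType) (V : zmodType) (P : pred E) (t : E -> H)
    (F : E * H -> V) :
  \sum_(x | P x.1 && (x.2 == t x.1)) F x = \sum_(e | P e) F (e, t e).
Proof.
transitivity (\sum_(e | P e) \sum_(h | h == t e) F (e, h)).
  by rewrite pair_big_dep; apply: eq_bigr => -[].
by apply: eq_bigr => e _; rewrite big_pred1_eq.
Qed.

Lemma delta_derived p (X : graph) (H : finGroupType) (a : edge X -> H)
    (v : vert X) (g : H) :
  delta p ((v, g) : vert (derived a)) =
    \sum_(e | src e == v)
      (dirac p ((v, g) : vert (derived a))
        - dirac p ((tgt e, (g * a e)%g) : vert (derived a)))
    + \sum_(e | tgt e == v)
      (dirac p ((v, g) : vert (derived a))
        - dirac p ((src e, (g * (a e)^-1)%g) : vert (derived a))).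
Proof.
rewrite /delta; congr (_ + _).
  rewrite -(sum_pair_graph (fun e => src e == v) (fun=> g) (fun x =>
    dirac p ((v, g) : vert (derived a))
        - dirac p ((tgt x.1, (x.2 * a x.1)%g) : vert (derived a)))).
  by apply: eq_bigl => -[e h].
transitivity (\sum_(x : edge X * H | (tgt x.1 == v) && (x.2 == g * (a x.1)^-1)%g)
  (dirac p ((v, g) : vert (derived a)) -
     dirac p ((src x.1, x.2) : vert (derived a)))).
  apply: eq_bigl => -[e h] /=.
  by rewrite -pair_eqE /pair_eq /= -(inj_eq (mulIg (a e)^-1%g)) mulgK.
exact: (sum_pair_graph (fun e => tgt e == v) (fun e => g * (a e)^-1)%g (fun x =>
    dirac p ((v, g) : vert (derived a))
        - dirac p ((src x.1, x.2) : vert (derived a)))).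
Qed.

Lemma fpush_dirac p (Y Z : graph) (f : vert Y -> vert Z) (v : vert Y) :
  fpush f (dirac p v) = dirac p (f v).
Proof.
apply/ffunP => w; rewrite !ffunE; have [->|wv] := eqVneq w (f v).
  rewrite (bigD1 v) //= ffunE eqxx big1 ?addr0 // => x /andP[_ /negPf xv].
  by rewrite ffunE xv.
rewrite big1 // => x /eqP xw; rewrite ffunE (_ : (_ == _) = false) //.
by apply: contraNF wv => /eqP <-; rewrite xw.
Qed.

Section DerivedMaps.
Variables (p : nat) (X : graph) (H K : finGroupType).
Variables (a : edge X -> H) (b : edge X -> K) (f : H -> K) (k : K).
Hypothesis fM : forall x y, f (x * y)%g = (f x * f y)%g.
Hypothesis fab : forall e, f (a e) = b e.

Definition derived_fun (x : vert (derived a)) : vert (derived b) :=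
  (x.1, (k * f x.2)%g).

Lemma derived_funP y :
  fpush derived_fun (delta p y) = delta p (derived_fun y).
Proof.
case: y => v g; rewrite !delta_derived linearD !linear_sum.
have fV x : f x^-1%g = (f x)^-1%g.
  have f1 : f 1%g = 1%g by apply: (mulgI (f 1%g)); rewrite -fM !mulg1.
  by apply: (mulgI (f x)); rewrite -fM !mulgV.
have push_dirac := @fpush_dirac p (derived a) (derived b) derived_fun.
congr (_ + _); apply: eq_bigr => e _; rewrite linearB;
  congr (_ - _); (etransitivity; first exact: push_dirac) => //.
  by rewrite /derived_fun /= fM fab mulgA.
by rewrite /derived_fun /= fM fV fab mulgA.
Qed.

Definition derived_map : covmap p (derived a) (derived b) := CovMap derived_funP.

End DerivedMaps.

Section Translations.
Variables (p : nat) (X : graph) (H : finGroupType) (a : edge X -> H).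

Definition transl (h : H) : covmap p (derived a) (derived a) :=
  @derived_map p X H H a a id h (fun _ _ => erefl) (fun _ => erefl).

Definition Pic_act (h : H) : {linear Pic p (derived a) -> Pic p (derived a)} :=
  Pic_map (transl h).
Definition J_act (h : H) : {linear J p (derived a) -> J p (derived a)} :=
  J_map (transl h).

Lemma transl1 : transl 1%g =1 id.
Proof. by case=> v g; rewrite /= /derived_fun mul1g. Qed.
Lemma translM g h : transl (g * h)%g =1 transl g \o transl h.
Proof. by case=> v x; rewrite /= /derived_fun mulgA. Qed.

Lemma Pic_actP : is_action Pic_act.
Proof.
split=> [x|g h x]; first exact/Pic_map_id/transl1.
exact/esym/Pic_map_comp/translM.
Qed.

Lemma J_actP : is_action J_act.
Proof.
split=> [x|g h x]; first exact/J_map_id/transl1.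
exact/esym/J_map_comp/translM.
Qed.

End Translations.

Lemma gmod_push (R : pzRingType) (H K : finGroupType) (V W : lmodType R)
    (f : H -> K) (act : H -> {linear V -> V}) (act' : K -> {linear W -> W})
    (phi : {linear V -> W}) (a : galg R H) (x : V) :
  (forall h y, phi (act h y) = act' (f h) (phi y)) ->
  phi (gmod_scale act a x) = gmod_scale act' (galg_map f a) (phi x).
Proof.
move=> hphi; rewrite /gmod_scale linear_sum.
under eq_bigr => h _ do rewrite linearZ /= hphi.
rewrite (partition_big f predT) //=; apply: eq_bigr => k _.
by rewrite ffunE scaler_suml; apply: eq_bigr => h /eqP ->.
Qed.

Section DerivedTower.
Variables (p : nat) (G : profiniteGroupType) (X : graph) (alpha : edge X -> G).

Definition derivedU (U : openNormal G) : graph :=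
  derived (fun e => piq U (alpha e)).

(* Pic and J of the derived graph as Lambda-modules: G/U acts by left
   translation of the second coordinate, this extends to Z_p[G/U], and Lambda
   acts through its projection to Z_p[G/U]. *)
Definition PicU (U : openNormal G) : lmodType (Lambda p G) :=
  restr (gmod (Pic_actP p (fun e => piq U (alpha e)))) (Lambda_proj p U).
Definition JU (U : openNormal G) : lmodType (Lambda p G) :=
  restr (gmod (J_actP p (fun e => piq U (alpha e)))) (Lambda_proj p U).

Section Transition.
Variables (V U : openNormal G) (h : on_le V U).

Definition derivedU_map : covmap p (derivedU U) (derivedU V) :=
  @derived_map p X _ _ (fun e => piq U (alpha e)) (fun e => piq V (alpha e))
    (quotmap V) 1%g (quotmapM h) (fun e => quotmap_pi (alpha e) h).

Definition PicU_fun : PicU U -> PicU V := Pic_map derivedU_map.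
Definition JU_fun : JU U -> JU V := J_map derivedU_map.

Lemma Pic_map_act g (x : Pic p (derivedU U)) :
  Pic_map derivedU_map (Pic_act p _ g x)
  = Pic_act p _ (quotmap V g) (Pic_map derivedU_map x).
Proof.
pose c := @derived_map p X _ _ (fun e => piq U (alpha e))
  (fun e => piq V (alpha e)) (quotmap V) (quotmap V g) (quotmapM h)
  (fun e => quotmap_pi (alpha e) h).
rewrite /Pic_act (@Pic_map_comp _ _ _ _ _ _ c); last first.
  by case=> v y; rewrite /= /derived_fun /= mul1g (quotmapM h).
rewrite (@Pic_map_comp _ _ _ _ _ _ c) //.
by case=> v y; rewrite /= /derived_fun /= mul1g.
Qed.

Lemma J_map_act g (x : J p (derivedU U)) :
  J_map derivedU_map (J_act p _ g x)
  = J_act p _ (quotmap V g) (J_map derivedU_map x).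
Proof.
pose c := @derived_map p X _ _ (fun e => piq U (alpha e))
  (fun e => piq V (alpha e)) (quotmap V) (quotmap V g) (quotmapM h)
  (fun e => quotmap_pi (alpha e) h).
rewrite /J_act (@J_map_comp _ _ _ _ _ _ c); last first.
  by case=> v y; rewrite /= /derived_fun /= mul1g (quotmapM h).
rewrite (@J_map_comp _ _ _ _ _ _ c) //.
by case=> v y; rewrite /= /derived_fun /= mul1g.
Qed.

Fact PicU_fun_is_zmod_morphism : zmod_morphism PicU_fun.
Proof. exact: (raddfB (Pic_map derivedU_map)). Qed.

Fact PicU_fun_is_scalable : scalable PicU_fun.
Proof.
move=> a x; rewrite -[RHS]/(gmod_scale _ (limr a V) _) -(limrP a h).
exact: (@gmod_push (padic p) (quotg U) (quotg V) _ _ (quotmap V)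
  _ _ (Pic_map derivedU_map) (limr a U) x Pic_map_act).
Qed.

Fact JU_fun_is_zmod_morphism : zmod_morphism JU_fun.
Proof. exact: (raddfB (J_map derivedU_map)). Qed.

Fact JU_fun_is_scalable : scalable JU_fun.
Proof.
move=> a x; rewrite -[RHS]/(gmod_scale _ (limr a V) _) -(limrP a h).
exact: (@gmod_push (padic p) (quotg U) (quotg V) _ _ (quotmap V)
  _ _ (J_map derivedU_map) (limr a U) x J_map_act).
Qed.

Definition PicU_tr : {linear PicU U -> PicU V} :=
  HB.pack PicU_fun
    (GRing.isZmodMorphism.Build _ _ _ PicU_fun_is_zmod_morphism)
    (GRing.isScalable.Build _ _ _ _ _ PicU_fun_is_scalable).

Definition JU_tr : {linear JU U -> JU V} :=
  HB.pack JU_fun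
    (GRing.isZmodMorphism.Build _ _ _ JU_fun_is_zmod_morphism)
    (GRing.isScalable.Build _ _ _ _ _ JU_fun_is_scalable).

End Transition.

Section Limits.
Variables (l : nat) (uG : uniform_pro_p p l G).

Definition Xn (n : nat) : graph := derivedU (Gn uG n).

Definition Gn_le (m n : nat) (mn : (m <= n)%N) : on_le (Gn uG m) (Gn uG n) :=
  @powgS G p m n mn.

Definition Pic_inf : lmodType (Lambda p G) :=
  limmod (fun m n (mn : (m <= n)%N) => PicU_tr (Gn_le mn)).

Definition J_inf : lmodType (Lambda p G) :=
  limmod (fun m n (mn : (m <= n)%N) => JU_tr (Gn_le mn)).

End Limits.
End DerivedTower.

Section ModuleNotions.
Variable R : pzRingType.

Definition fin_gen (M : lmodType R) : Prop :=
  exists n (g : 'I_n -> M), forall x, exists c : 'I_n -> R,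
    x = \sum_i c i *: g i.

Definition has_dim (M : lmodType R) (d : nat) : Prop :=
  exists b : 'I_d -> M, forall x, exists! c : 'rV[R]_d, x = \sum_i c 0 i *: b i.

Definition projective (P : lmodType R) : Prop :=
  forall (M N : lmodType R) (g : {linear M -> N}) (f : {linear P -> N}),
    (forall y, exists x, g x = y) ->
    exists h : {linear P -> M}, forall x, g (h x) = f x.

(* The beginning res2 -> res1 -> res0 -> M -> 0 of a projective resolution,
   which is all that Ext^1 depends on. *)
Record proj_resolution2 (M : lmodType R) := ProjResolution2 {
  res0 : lmodType R;
  res1 : lmodType R;
  res2 : lmodType R;
  res_d2 : {linear res2 -> res1};
  res_d1 : {linear res1 -> res0};
  res_aug : {linear res0 -> M};
  res0P : projective res0;
  res1P : projective res1;
  res2P : projective res2;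
  res_aug_surj : forall y, exists x, res_aug x = y;
  res_exact0 : forall x, res_aug x = 0 <-> exists y, res_d1 y = x;
  res_exact1 : forall x, res_d1 x = 0 <-> exists y, res_d2 y = x }.

(* Ext^1(M, N) = H^1 (Hom (res, N)); its vanishing does not depend on the
   resolution used to compute it. *)
Definition Ext1_zero (M N : lmodType R) : Prop :=
  exists P : proj_resolution2 M, forall f : {linear res1 P -> N},
    (forall x, f (res_d2 P x) = 0) ->
    exists g : {linear res0 P -> N}, forall x, f x = g (res_d1 P x).

End ModuleNotions.

Section Fractions.
Variables (R : pzRingType) (Q : unitRingType) (iota : {rmorphism R -> Q}).

(* Left fractions, as befits left modules; left and right fractions agree over
   a ring that is Noetherian on both sides. *)
Definition is_fraction_skew_field : Prop :=
  [/\ forall q : Q, q != 0 -> q \is a GRing.unit,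
      injective iota
    & forall q : Q, exists a s : R, s != 0 /\ q = (iota s)^-1 * iota a].

Definition tensor_rel (M : lmodType R) : set {freeg M / Q} :=
  [set u | (exists x y : M, u = << x + y >> - << x >> - << y >>)
        \/ (exists (a : R) (x : M), u = << a *: x >> - iota a *: << x >>)].

(* Q (x)_R M: the free left Q-module on M modulo additivity in M and
   [a x] = iota a [x]. *)
Definition tensorQ (M : lmodType R) : lmodType Q :=
  quotmod (lspan (@tensor_rel M)).

Definition torsion (M : lmodType R) : Prop :=
  fin_gen M /\ has_dim (tensorQ M) 0.

Definition pseudo_null (M : lmodType R) : Prop :=
  torsion M /\ Ext1_zero M R^o.

Definition no_pseudo_null_submod (M : lmodType R) : Prop :=
  forall N : submodClosed M, pseudo_null (submod N) ->
    forall x : M, x \in N -> x = 0.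

End Fractions.

(* Main.v *)
(**
Let F be the free Lambda-module on the vertices of X.  It is the limit of the
Div(X_n), and the Laplacians of the X_n define an endomorphism d of F.

- d is injective.  Harmonic divisors on the connected graph X_n are constant
  (over Q by positivity of the energy, over Z_p by clearing denominators), and
  the transition maps multiply constants by a multiple of p.
- Pic_inf = F / d F, since the Z_p-modules Div(X_n) are compact; compactness is
  used through limits along a free ultrafilter, which are linear.
- An injective endomorphism of a finite free module over a left Ore domain has
  torsion cokernel, so Pic_inf is torsion.  J_inf embeds into Pic_inf, and it is
  generated by the boundaries of the edges of X.
- Let N be a submodule of F / d F with preimage N' in F.  If Ext^1(N, Lambda)
  vanishes, the coordinates of d^-1 : d F -> F extend to N', which splits
  d F -> N'; as N' is torsion-free and N is torsion, N = 0.
*)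

Require Import Defs.
From HB Require Import structures.
From mathcomp Require Import freeg.
From mathcomp Require Import all_boot all_order all_algebra fingroup cyclic.
From mathcomp Require Import boolp classical_sets topology.

Set Implicit Arguments.
Unset Strict Implicit.
Unset Printing Implicit Defensive.

Import Order.TTheory GRing.Theory Num.Theory.

(** * Modules over a ring with a skew field of left fractions *)

Section FractionSkewField.
Local Open Scope ring_scope.
Variables (R : pzRingType) (Q : unitRingType) (iota : {rmorphism R -> Q}).
Hypothesis QR : is_fraction_skew_field iota.

Lemma fraction_unit (a : R) : a != 0 -> iota a \is a GRing.unit.
Proof.
by case: QR => unitQ inj _ a0; apply: unitQ; rewrite -(rmorph0 iota) (inj_eq inj).
Qed.

Lemma fraction_mul_neq0 (a b : R) : a != 0 -> b != 0 -> a * b != 0.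
Proof.
move=> a0 b0; apply: contraNneq b0 => ab0; case: QR => _ inj _.
apply/eqP/inj; apply: (mulrI (fraction_unit a0)).
by rewrite rmorph0 mulr0 -rmorphM ab0 rmorph0.
Qed.

Lemma fraction_scale_eq0 (V : finType) (s : R) (x : {ffun V -> R^o}) :
  s != 0 -> s *: x = 0 -> x = 0.
Proof.
move=> s0 /ffunP sx0; apply/ffunP => v; have := sx0 v; rewrite !ffunE.
move=> h; apply/eqP; apply: contraTT isT => xv0.
by have := fraction_mul_neq0 s0 xv0; rewrite [_ * _]h eqxx.
Qed.

(** The left Ore condition: the right fraction a b^-1 is rewritten as a left fraction s^-1 t, and
    denominators are cleared. *)
Lemma fraction_ore (a b : R) : b != 0 ->
  exists s t : R, s != 0 /\ s * a = t * b.
Proof.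
move=> b0; have [_ inj frac] := QR.
have [t [s [s0 e]]] := frac (iota a * (iota b)^-1); exists s, t; split=> //.
apply: inj; rewrite !rmorphM; apply: (mulIr (x := (iota b)^-1)).
  by rewrite unitrV fraction_unit.
by rewrite -mulrA e mulVKr ?fraction_unit // mulrK ?fraction_unit.
Qed.

(** Gaussian elimination by induction on [n]: Ore multipliers [s] and [t] replace division by the
    pivot of the first column. *)
Lemma fraction_dependent n (v : 'I_n.+1 -> 'I_n -> R) :
  exists c : 'I_n.+1 -> R,
    (exists i, c i != 0) /\ forall j, \sum_i c i * v i j = 0.
Proof.
have one_neq0 : (1 : R) != 0.
  apply/eqP => /(congr1 iota); rewrite rmorph1 rmorph0 => /eqP.
  by rewrite oner_eq0.
elim: n v => [|n IHn] v; first by exists (fun=> 1); split=> [|[]//]; exists ord0.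
have [i0 hi0] : exists i0, forall i, exists st : R * R,
    st.1 != 0 /\ st.1 * v i ord0 = st.2 * v i0 ord0.
  have [/existsP[i0 vi0]|/existsPn h0] := boolP [exists i, v i ord0 != 0].
    exists i0 => i; have [s [t [s0 e]]] := fraction_ore (v i ord0) vi0.
    by exists (s, t).
  (* In a zero column any row serves as pivot, with multipliers 1 and 0. *)
  exists ord0 => i; exists (1, 0); split => //=.
  by have /negPn/eqP -> := h0 i; rewrite mulr0 mul0r.
have [st hst] := choice hi0.
pose s i := (st i).1; pose t i := (st i).2.
have [c [[k ck] hc]] := IHn (fun i j =>
  s (lift i0 i) * v (lift i0 i) (lift ord0 j)
    - t (lift i0 i) * v i0 (lift ord0 j)).
(* Back to the original rows: the pivot row collects what was subtracted from the others. *)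
pose d i := if unlift i0 i is Some i' then c i' * s i
            else - \sum_i' c i' * t (lift i0 i').
exists d; split=> [|j].
  exists (lift i0 k); rewrite /d liftK; apply: fraction_mul_neq0 => //.
  by have [] := hst (lift i0 k).
rewrite (bigD1_ord i0) //= {1}/d unlift_none mulNr mulr_suml addrC.
under eq_bigr => i _ do rewrite /d liftK.
rewrite -sumrB.
have [j' ->|->] := unliftP ord0 j.
  by rewrite -[RHS](hc j'); apply: eq_bigr => i _; rewrite mulrBr !mulrA.
apply: big1 => i _; rewrite -!mulrA -mulrBr.
by have [_ /= ->] := hst (lift i0 i); rewrite subrr mulr0.
Qed.

(** Together, [x] and the images of the basis are one vector too many, hence dependent. The
    coefficient of [x] cannot vanish, since injectivity of [d] would then kill all the others. *)
Lemma injective_endo_torsion_coker (V : finType)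
    (d : {linear {ffun V -> R^o} -> {ffun V -> R^o}}) :
  (forall y, d y = 0 -> y = 0) ->
  forall x, exists s y, s != 0 /\ s *: x = d y.
Proof.
move=> d_inj x; pose e (v : V) : {ffun V -> R^o} := [ffun w => (w == v)%:R].
have expand (y : {ffun V -> R^o}) : y = \sum_v y v *: e v.
  apply/ffunP => w; rewrite sum_ffunE (bigD1 w) //= big1 => [|v vw].
    by rewrite !ffunE eqxx [_ *: _]mulr1 addr0.
  by rewrite !ffunE eq_sym (negPf vw) [_ *: _]mulr0.
pose f (i : 'I_#|V|.+1) : {ffun V -> R^o} :=
  if unlift ord0 i is Some i' then d (e (enum_val i')) else x.
have [c [[k ck] hc]] := fraction_dependent (fun i j => f i (enum_val j)).
pose y : {ffun V -> R^o} := [ffun v => c (lift ord0 (enum_rank v))].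
have rel : c ord0 *: x + d y = 0.
  rewrite (expand y) linear_sum (reindex_onto enum_val enum_rank) /=; last first.
    by move=> v _; rewrite enum_rankK.
  apply/ffunP => v; rewrite ffunE sum_ffunE [RHS]ffunE.
  rewrite -[RHS](hc (enum_rank v)) big_ord_recl ffunE /f unlift_none enum_rankK.
  congr (_ + _); apply: eq_big => [i|i _]; first by rewrite enum_valK eqxx.
  by rewrite linearZ /= !ffunE enum_valK liftK.
exists (c ord0), (- y); split; last by rewrite linearN; apply/eqP; rewrite -addr_eq0 rel.
apply/eqP => c0; move: rel; rewrite c0 scale0r add0r => /d_inj /ffunP y0.
move: ck; have [k' ->|->] := unliftP ord0 k; last by rewrite c0 eqxx.
by have := y0 (enum_val k'); rewrite !ffunE enum_valK => ->; rewrite eqxx.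
Qed.

(** If [s] kills [x], the class of [x] in the tensor product is (iota s)^-1 times the class of s x =
    0. Such classes generate the tensor product. *)
Lemma torsion_of_annihilated (M : lmodType R) :
  fin_gen M -> (forall x : M, exists2 s : R, s != 0 & s *: x = 0) ->
  torsion iota M.
Proof.
move=> fgM torM; split=> //.
exists (fun=> 0) => x; exists 0; split=> [|c' _]; last first.
  by apply/matrixP => i [].
rewrite big_ord0 -(reprNK x); apply/eqP.
have -> : 0 = piN (lspan (tensor_rel iota (M := M))) 0 by rewrite linear0.
rewrite piN_eq subr0; set S := lspan _.
have SN u : - u \in S -> u \in S.
  by move=> /(rpredZ (-1)); rewrite scaleN1r opprK.
(* The additivity relation for 0 + 0 reduces to - << 0 >>. *)
have S0 : << (0 : M) >> \in S.
  apply: SN; apply: mem_lspan; left; exists 0, 0.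
  by rewrite addr0 subrr add0r.
have Sx (y : M) : << y >> \in S.
  have [s s0 sy] := torM y.
  have : iota s *: << y >> - << s *: y >> \in S.
    by apply: SN; rewrite opprB; apply: mem_lspan; right; exists s, y.
  rewrite sy => /rpredD /(_ S0); rewrite subrK => /(rpredZ (iota s)^-1).
  by rewrite scalerA mulVr ?fraction_unit // scale1r.
elim/freeg_ind_dom0: (reprN x) => [|k y D _ _ DS]; first exact: rpred0.
have -> : << k *g y >> = k *: << y >>.
  by apply/eqP/freeg_eqP => z; rewrite coeffZ !coeffU mul1r.
by rewrite rpredD // rpredZ.
Qed.

(* A lift [a] of the augmentation to the free module is, on boundaries,
   [d \o b]; vanishing of Ext^1 turns [b] into [g \o res_d1], and then
   [a - d \o g] has torsion image in a torsion-free module, so it is zero. *)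
Lemma ext1_zero_embed_coker (V : finType) (M N : lmodType R)
    (d : {linear {ffun V -> R^o} -> {ffun V -> R^o}})
    (pi : {linear {ffun V -> R^o} -> M}) (i : {linear N -> M}) :
  (forall y, d y = 0 -> y = 0) ->
  (forall m, exists x, pi x = m) ->
  (forall x, pi x = 0 <-> exists y, d y = x) ->
  (forall x, i x = 0 -> x = 0) ->
  Ext1_zero N R^o -> forall x : N, x = 0.
Proof.
move=> d_inj pi_surj pi_ker i_inj [P ext0].
pose iaug : {linear res0 P -> M} := i \o @res_aug _ _ P.
have [a ha] := res0P (g := pi) iaug pi_surj.
have hb z : exists y, d y = a (res_d1 P z).
  apply/pi_ker; rewrite ha /=.
  have -> : res_aug P (res_d1 P z) = 0 by apply/res_exact0; exists z.
  exact: linear0.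
have [b bE] := choice hb.
have b_lin : linear b.
  move=> c u v; apply/eqP; rewrite -subr_eq0; apply/eqP/d_inj.
  by rewrite linearB (linearP d) /= !bE -linearP -linearP subrr.
(* Ext^1 has values in [R], so [b] is extended one coordinate at a time; each coordinate is a
   cocycle because [d] is injective. *)
have coord v : exists g : {linear res0 P -> R^o},
    forall z, b z v = g (res_d1 P z).
  have bv_lin : linear (fun z => b z v : R^o).
    by move=> c u w; rewrite b_lin !ffunE.
  pose bv : {linear res1 P -> R^o} :=
    HB.pack (fun z => b z v : R^o) (GRing.isLinear.Build _ _ _ _ _ bv_lin).
  apply: (ext0 bv) => y /=.
  suff -> : b (res_d2 P y) = 0 by rewrite ffunE.
  apply: d_inj; rewrite bE.
  have -> : res_d1 P (res_d2 P y) = 0 by apply/res_exact1; exists y.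
  exact: linear0.
have [g gE] := choice coord.
move=> x; have [y <-] := res_aug_surj P x.
pose gy : {ffun V -> R^o} := [ffun v => g v y].
(* The cokernel of [d] is torsion, so some nonzero multiple of [y] maps to 0 in [M], hence in [N],
   and is a boundary. *)
have [s [w [s0 sw]]] := injective_endo_torsion_coker d_inj (a y).
have [z hz] : exists z, res_d1 P z = s *: y.
  apply/res_exact0/i_inj; rewrite -[i _]/(iaug _) -ha.
  by apply/pi_ker; exists w; rewrite linearZ /= sw.
apply: i_inj; rewrite -[i _]/(iaug _) -ha; apply/pi_ker; exists gy.
apply/esym/eqP; rewrite -subr_eq0; apply/eqP/(fraction_scale_eq0 s0).
rewrite scalerBr -!linearZ /= -hz -bE -linearB.
have -> : b z = s *: gy by apply/ffunP => v; rewrite !ffunE gE hz linearZ.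
by rewrite subrr linear0.
Qed.

End FractionSkewField.

(** * Ultralimits of p-adic integers *)

Section Ultralimit.
Local Open Scope classical_set_scope.
Local Open Scope ring_scope.
Variable p : nat.

Definition nat_ultra : set_system nat :=
  sval (cid (ultraFilterLemma (eventually_filter : ProperFilter \oo))).

Instance nat_ultra_proper : ProperFilter nat_ultra.
Proof. exact: (@ultra_proper _ _ (svalP (cid (ultraFilterLemma _))).1). Qed.

Let nat_ultraI := @filterI _ nat_ultra nat_ultra_proper.

Lemma nat_ultra_ge n : nat_ultra [set N | (n <= N)%N].
Proof. by apply: (svalP (cid (ultraFilterLemma _))).2; exists n. Qed.

(** Otherwise the ultrafilter contains the complements of all fibres, and so their finite
    intersection, which is empty. *)
Lemma nat_ultra_const (T : finType) (f : nat -> T) :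
  exists t, nat_ultra [set N | f N = t].
Proof.
have ultraP := (svalP (cid (ultraFilterLemma
  (eventually_filter : ProperFilter \oo)))).1.
apply: contrapT => none.
have : nat_ultra [set N | forall t, f N <> t].
  apply: filter_forall => t.
  have [h|//] := in_ultra_setVsetC [set N | f N = t] ultraP.
  by case: none; exists t.
by move=> /filter_ex [N] /(_ (f N)).
Qed.

Definition ulimf (T : finType) (f : nat -> T) : T := sval (cid (nat_ultra_const f)).

Lemma ulimfP (T : finType) (f : nat -> T) : nat_ultra [set N | f N = ulimf f].
Proof. exact: (svalP (cid (nat_ultra_const f))). Qed.

Lemma ulimf_unique (T : finType) (f : nat -> T) t :
  nat_ultra [set N | f N = t] -> ulimf f = t.
Proof. by move=> h; have [N [<- <-]] := filter_ex (filterI (ulimfP f) h). Qed.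

(** [Zpk] is declared only as a ring; naming the underlying ordinal type supplies its finiteness. *)
Definition ulimk k (f : nat -> Zpk p k) : Zpk p k :=
  @ulimf 'I_(Zp_trunc (p ^ k.+1)).+2 f.

Lemma ulimk_unique k (f : nat -> Zpk p k) t :
  nat_ultra [set N | f N = t] -> ulimk f = t.
Proof. exact: (@ulimf_unique 'I_(Zp_trunc (p ^ k.+1)).+2). Qed.

Lemma ulimkP k (f : nat -> Zpk p k) : nat_ultra [set N | f N = ulimk f].
Proof. exact: (@ulimfP 'I_(Zp_trunc (p ^ k.+1)).+2). Qed.

Fact ulim_subproof (x : nat -> padic p) i j (ij : (i <= j)%N) :
  Zpk_tr p ij (ulimk (fun N => limr (x N) j)) = ulimk (fun N => limr (x N) i).
Proof.
apply/esym/ulimk_unique; apply: filterS (ulimkP (fun N => limr (x N) j)) => N /= <-.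
exact: (esym (limrP (x N) ij)).
Qed.

(* The limit of a sequence of p-adic integers along a free ultrafilter: a
   linear choice of limits that replaces compactness arguments. *)
Definition ulim (x : nat -> padic p) : padic p := LimRing (ulim_subproof x).

Lemma ulim_eventually (x : nat -> padic p) c n :
  (forall N, (n <= N)%N -> x N = c) -> ulim x = c.
Proof.
move=> xc; apply: limr_inj => k; apply: ulimk_unique.
by apply: filterS (nat_ultra_ge n) => N /= /xc ->.
Qed.

Lemma eq_ulim_eventually (x y : nat -> padic p) n :
  (forall N, (n <= N)%N -> x N = y N) -> ulim x = ulim y.
Proof.
move=> xy; apply: limr_inj => k; apply: ulimk_unique.
have h := nat_ultraI (nat_ultra_ge n) (ulimkP (fun N => limr (y N) k)).
by move: h; apply: filterS => N [/= /xy -> <-].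
Qed.

Lemma ulimD (x y : nat -> padic p) :
  ulim (fun N => x N + y N) = ulim x + ulim y.
Proof.
apply: limr_inj => k; apply: ulimk_unique.
have h := nat_ultraI (ulimkP (fun N => limr (x N) k)) (ulimkP (fun N => limr (y N) k)).
by move: h; apply: filterS => N /= [<- <-].
Qed.

Lemma ulimM c (x : nat -> padic p) : ulim (fun N => x N * c) = ulim x * c.
Proof.
apply: limr_inj => k; apply: ulimk_unique.
by apply: filterS (ulimkP (fun N => limr (x N) k)) => N /= <-.
Qed.

Lemma ulim_sum (I : Type) (r : seq I) (P : pred I) (x : I -> nat -> padic p) :
  ulim (fun N => \sum_(i <- r | P i) x i N) = \sum_(i <- r | P i) ulim (x i).
Proof.
elim: r => [|i r IHr].
  by rewrite big_nil; apply: (ulim_eventually (n := 0)) => N _; rewrite big_nil.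
have cons_sum N : \sum_(j <- i :: r | P j) x j N =
    (if P i then x i N else 0) + \sum_(j <- r | P j) x j N.
  by rewrite big_cons; case: ifP; rewrite ?add0r.
rewrite (funext cons_sum) ulimD IHr big_cons; case: ifP => // _.
by rewrite (ulim_eventually (c := 0) (n := 0)) ?add0r.
Qed.

Definition ulim_fun (S : finType) (D : nat -> {ffun S -> (padic p)^o}) :
    {ffun S -> (padic p)^o} :=
  [ffun s => ulim (fun N => D N s)].

Lemma ulim_fun_cst (S : finType) (D : {ffun S -> (padic p)^o}) :
  ulim_fun (fun=> D) = D.
Proof. by apply/ffunP => s; rewrite ffunE; apply: (ulim_eventually (n := 0)). Qed.

Lemma eq_ulim_fun (S : finType) (D E : nat -> {ffun S -> (padic p)^o}) n :
  (forall N, (n <= N)%N -> D N = E N) -> ulim_fun D = ulim_fun E.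
Proof.
move=> DE; apply/ffunP => s; rewrite !ffunE.
by apply: (eq_ulim_eventually (n := n)) => N /DE ->.
Qed.

Lemma ulim_funD (S : finType) (D E : nat -> {ffun S -> (padic p)^o}) :
  ulim_fun (fun N => D N + E N) = ulim_fun D + ulim_fun E.
Proof.
apply/ffunP => s; rewrite !ffunE -ulimD; congr ulim.
by apply/funext => N; rewrite ffunE.
Qed.

(** The form in which ultralimits pass through [lap] and [bdry], which are both such
    combinations. *)
Lemma ulim_fun_lincomb (S T : finType) (D : nat -> {ffun S -> (padic p)^o})
    (E : S -> {ffun T -> (padic p)^o}) :
  \sum_s ulim_fun D s *: E s = ulim_fun (fun N => \sum_s D N s *: E s).
Proof.
apply/ffunP => t; rewrite sum_ffunE ffunE.
rewrite (_ : (fun N => _) = (fun N => \sum_s D N s * E s t)); last first.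
  by apply/funext => N; rewrite sum_ffunE; apply: eq_bigr => s _; rewrite ffunE.
by rewrite ulim_sum; apply: eq_bigr => s _; rewrite !ffunE ulimM.
Qed.

Lemma fpush_ulim_fun (S T : finType) (f : S -> T)
    (D : nat -> {ffun S -> (padic p)^o}) :
  fpush f (ulim_fun D) = ulim_fun (fun N => fpush f (D N)).
Proof.
apply/ffunP => t; rewrite !ffunE.
rewrite (_ : (fun N => _) = (fun N => \sum_(s | f s == t) D N s)); last first.
  by apply/funext => N; rewrite ffunE.
by rewrite ulim_sum; apply: eq_bigr => s _; rewrite ffunE.
Qed.

End Ultralimit.

(** * p-adic integers *)

Section PadicTorsionFree.
Local Open Scope ring_scope.
Variables (p : nat) (p_pr : prime p).

Lemma Zpk_natr_eq0 k n : ((n%:R : Zpk p k) == 0) = (p ^ k.+1 %| n)%N.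
Proof.
have p1 : (1 < p ^ k.+1)%N by rewrite -(exp1n k.+1) ltn_exp2r // prime_gt1.
by rewrite -val_eqE /= Zpk_natr Zp_cast.
Qed.

Lemma limr_natr k n : limr (n%:R : padic p) k = n%:R.
Proof. exact: (rmorph_nat (limr_proj (tr := Zpk_tr p) k)). Qed.

Lemma padic_natr_reg (n : nat) (x : padic p) : (0 < n)%N -> x * n%:R = 0 -> x = 0.
Proof.
move=> n0 xn0; apply: limr_inj => k.
(* Level [k] is Z/p^(k+1). Multiplication by [n] costs [logn p n] factors of p, so the vanishing of
   the product is read that many levels higher. *)
have kj : (k <= k + logn p n)%N by exact: leq_addr.
rewrite -(limrP x kj) /= /Zpk_map; apply/eqP.
set y := limr x _; rewrite Zpk_natr_eq0.
have /eqP : (y : nat)%:R * n%:R = 0 :> Zpk p (k + logn p n).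
  by rewrite natr_Zp -limr_natr -[LHS]/(limr (x * n%:R) _) xn0.
rewrite -natrM Zpk_natr_eq0 => h; have [->|y0] := posnP (y : nat); first exact: dvdn0.
rewrite pfactor_dvdn //; rewrite pfactor_dvdn ?muln_gt0 ?y0 // lognM // in h.
by rewrite -(leq_add2r (logn p n)).
Qed.

Lemma padic_expn_eq0 k n (x : padic p) :
  (k < n)%N -> limr (x * (p ^ n)%:R) k = 0.
Proof.
move=> kn; rewrite -[LHS]/(limr x k * limr (p ^ n)%:R k) limr_natr.
have /eqP -> : ((p ^ n)%:R : Zpk p k) == 0 by rewrite Zpk_natr_eq0 dvdn_exp2l.
by rewrite mulr0.
Qed.

End PadicTorsionFree.

(** * Graph Laplacians *)

Lemma sum_eq_mul (R : pzRingType) (T : finType) (f : T -> R) (u : T) :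
  (\sum_v (v == u)%:R * f v = f u)%R.
Proof.
rewrite (bigD1 u) //= eqxx mul1r big1 ?addr0 // => v /negPf ->.
exact: mul0r.
Qed.

Section Laplacian.
Local Open Scope ring_scope.
Variable Y : graph.

Definition incid (R : pzRingType) (e : edge Y) (v : vert Y) : R :=
  (src e == v)%:R - (tgt e == v)%:R.

(** The incidence matrix times its transpose, over any ring: the product form yields the energy
    identity, and results over [rat] pass through [int] to the p-adic integers. A loop has zero
    incidence. *)
Definition lapm (R : pzRingType) (v w : vert Y) : R :=
  \sum_(e : edge Y) incid R e v * incid R e w.

Lemma lapm_morph (R S : pzRingType) (f : {rmorphism R -> S}) v w :
  f (lapm R v w) = lapm S v w.
Proof.
rewrite rmorph_sum; apply: eq_bigr => e _.
by rewrite rmorphM !rmorphB !rmorph_nat.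
Qed.

Lemma lapmC (R : comPzRingType) v w : lapm R v w = lapm R w v.
Proof. by apply: eq_bigr => e _; rewrite mulrC. Qed.

Lemma sum_incid (R : pzRingType) e (f : vert Y -> R) :
  \sum_v incid R e v * f v = f (src e) - f (tgt e).
Proof.
rewrite -[in RHS](sum_eq_mul f (src e)) -[in RHS](sum_eq_mul f (tgt e)) -sumrB.
by apply: eq_bigr => v _; rewrite mulrBl ![_ == v]eq_sym.
Qed.

Hypothesis conY : connected_graph Y.

Lemma connected_const (T : eqType) (f : vert Y -> T) :
  (forall e, f (src e) = f (tgt e)) -> forall u v, f u = f v.
Proof.
move=> fe u v; have [_ /(_ u v)/connectP[s]] := conY.
elim: s u => [|w s IHs] u /=; first by move=> _ ->.
move=> /andP[/existsP[e he] ps] vE; rewrite -(IHs w ps vE).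
by case/orP: he => /andP[/eqP <- /eqP <-]; rewrite fe.
Qed.

Lemma lapm_rat_ker (f : vert Y -> rat) :
  (forall v, \sum_w lapm rat v w * f w = 0) -> forall u v, f u = f v.
Proof.
move=> f_harm; apply: connected_const => e.
(* The energy is the quadratic form of the Laplacian, evaluated at the harmonic function [f]. *)
have energy : \sum_e (f (src e) - f (tgt e)) ^+ 2 = 0.
  transitivity (\sum_v f v * \sum_w lapm rat v w * f w); last first.
    by apply: big1 => v _; rewrite f_harm mulr0.
  under eq_bigr => e' _ do rewrite -sum_incid expr2 mulr_suml.
  rewrite exchange_big /=; apply: eq_bigr => v _.
  under [in RHS]eq_bigr => w _ do rewrite mulr_suml.
  rewrite [in RHS]exchange_big mulr_sumr /=; apply: eq_bigr => e' _.
  rewrite -!mulrA !mulr_sumr; apply: eq_bigr => w _.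
  by rewrite !mulrA [f v * _]mulrC.
have /psumr_eq0P : forall e, true -> 0 <= (f (src e) - f (tgt e)) ^+ 2.
  by move=> e' _; exact: sqr_ge0.
move=> /(_ energy e isT) /eqP; rewrite expf_eq0 /= subr_eq0.
by move/eqP.
Qed.

(** The columns of the cokernel matrix of the Laplacian are harmonic, hence constant, so they kill
    the difference of two basis vectors; that difference therefore lies in the row space. *)
Lemma lapm_rat_span (u v : vert Y) : exists b : vert Y -> rat,
  forall w, \sum_y b y * lapm rat y w = (w == u)%:R - (w == v)%:R.
Proof.
pose L : 'M[rat]_#|vert Y| := \matrix_(i, j) lapm rat (enum_val i) (enum_val j).
pose r : 'rV[rat]_#|vert Y| :=
  \row_j ((enum_val j == u)%:R - (enum_val j == v)%:R).
have sum_enum (F : vert Y -> rat) : \sum_y F y = \sum_j F (@enum_val _ (vert Y) j).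
  rewrite (reindex_onto (@enum_val _ (vert Y)) enum_rank) /=; last first.
    by move=> y _; rewrite enum_rankK.
  by apply: eq_bigl => i; rewrite enum_valK eqxx.
have : (r <= L)%MS.
  rewrite submxE; apply/eqP/matrixP => i j; rewrite !mxE.
  pose f w := cokermx L (enum_rank w) j.
  have f_const : forall x y, f x = f y.
    apply: lapm_rat_ker => w; rewrite sum_enum.
    transitivity ((L *m cokermx L) (enum_rank w) j); last by rewrite mulmx_coker mxE.
    by rewrite mxE; apply: eq_bigr => k _; rewrite mxE /f enum_valK enum_rankK.
  transitivity (\sum_y ((y == u)%:R - (y == v)%:R) * f u).
    rewrite sum_enum; apply: eq_bigr => k _.
    by rewrite mxE (f_const u (enum_val k)) /f enum_valK.
  under eq_bigr => y _ do rewrite mulrBl.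
  by rewrite sumrB !(sum_eq_mul (fun=> f u)) subrr.
case/submxP => b rE; exists (fun y => b 0 (enum_rank y)) => w.
have /matrixP/(_ 0 (enum_rank w)) := rE; rewrite !mxE enum_rankK => ->.
by rewrite sum_enum; apply: eq_bigr => k _; rewrite mxE enum_valK enum_rankK.
Qed.

Lemma lapm_int_span (u v : vert Y) : exists (N : nat) (b : vert Y -> int),
  (0 < N)%N /\ forall w, \sum_y b y * lapm int y w
                          = N%:R * ((w == u)%:R - (w == v)%:R).
Proof.
have [b bE] := lapm_rat_span u v.
pose N := (\prod_y `|denq (b y)|)%N.
(* This is [N] times [b y], written as an integer. *)
pose z y := numq (b y) * (\prod_(x | x != y) `|denq (b x)|)%N%:R.
exists N, z; split=> [|w].
  by apply: prodn_gt0 => y; rewrite absz_gt0 denq_neq0.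
apply: (@intr_inj rat); rewrite rmorphM rmorphB !rmorph_nat -bE mulr_sumr rmorph_sum.
apply: eq_bigr => y _; rewrite rmorphM lapm_morph mulrA; congr (_ * _).
rewrite /z rmorphM rmorph_nat /N [in RHS](bigD1 y) //= natrM.
have -> : (`|denq (b y)|%N%:R : rat) = (denq (b y))%:~R.
  by rewrite pmulrn absz_denq.
by rewrite numqE [RHS]mulrC mulrA.
Qed.

End Laplacian.

(** * The Laplacian on p-adic divisors *)

Section PadicLaplacian.
Local Open Scope ring_scope.
Variable p : nat.

(** Expanding the factor [incid e y] into its source and target terms gives, for each edge, its
    contributions to the two sums of [delta]. *)
Lemma delta_lapm (Y : graph) (y w : vert Y) : delta p y w = lapm (padic p) y w.
Proof.
rewrite /delta ffunE !sum_ffunE.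
under eq_bigr => e _ do rewrite !ffunE.
under [X in _ + X = _]eq_bigr => e _ do rewrite !ffunE.
rewrite big_mkcond [X in _ + X = _]big_mkcond -big_split; apply: eq_bigr => e _ /=.
rewrite /incid mulrBl !mulrBr.
rewrite ![_ == w]eq_sym.
case: (eqVneq (src e) y) => [->|_]; case: (eqVneq (tgt e) y) => [->|_] //=;
  by rewrite ?mul1r ?mul0r ?subr0 ?addr0 ?sub0r ?add0r ?opprB.
Qed.

Variable Y : graph.

Definition lap (D : Div p Y) : Div p Y := \sum_y D y *: delta p y.

Lemma lapE D w : lap D w = \sum_y D y * lapm (padic p) y w.
Proof. by rewrite sum_ffunE; apply: eq_bigr => y _; rewrite ffunE delta_lapm. Qed.

Fact lap_is_linear : linear lap.
Proof.
move=> c D E; rewrite /lap scaler_sumr -big_split; apply: eq_bigr => y _ /=.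
by rewrite !ffunE scalerDl scalerA.
Qed.
HB.instance Definition _ := GRing.isLinear.Build _ _ _ _ lap lap_is_linear.

Lemma lap_dirac y : lap (dirac p y) = delta p y.
Proof.
rewrite /lap (bigD1 y) //= ffunE eqxx scale1r big1 ?addr0 // => x /negPf xy.
by rewrite ffunE xy scale0r.
Qed.

Definition lapimp : pred (Div p Y) := fun D => `[< exists z, lap z = D >].

Fact lapimp_closed : submod_closed lapimp.
Proof.
split=> [|c D E /asboolP[z <-] /asboolP[t <-]]; apply/asboolP.
  by exists 0; rewrite linear0.
by exists (c *: z + t); rewrite linearP.
Qed.

Lemma mem_PrP D : reflect (exists z, lap z = D) (D \in Pr p Y).
Proof.
apply: (iffP idP) => [|[z <-]]; last first.
  by apply: rpred_sum => y _; apply/rpredZ/mem_lspan; exists y.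
pose K : submodClosed (Div p Y) :=
  HB.pack lapimp (GRing.isSubmodClosed.Build _ _ lapimp lapimp_closed).
move=> /(@lspan_sub _ _ _ K) h; apply/asboolP/h => _ [y _ <-].
by apply/asboolP; exists (dirac p y); rewrite lap_dirac.
Qed.

Lemma lap_ker D : prime p -> connected_graph Y -> lap D = 0 ->
  forall u v, D u = D v.
Proof.
move=> p_pr conY D0 u v; have [N [b [N0 bE]]] := lapm_int_span conY u v.
apply/eqP; rewrite -subr_eq0; apply/eqP; apply: (padic_natr_reg p_pr N0).
transitivity (\sum_w lap D w * (b w)%:~R); last first.
  by apply: big1 => w _; rewrite D0 ffunE mul0r.
under eq_bigr => w _ do rewrite lapE mulr_suml.
rewrite exchange_big /=.
transitivity (\sum_w D w * (N%:R * ((w == u)%:R - (w == v)%:R))); last first.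
  apply: eq_bigr => w _.
  have /(congr1 (intr : int -> padic p)) := bE w.
  rewrite rmorphM rmorphB !rmorph_nat => <-; rewrite rmorph_sum mulr_sumr.
  apply: eq_bigr => y _; rewrite rmorphM lapm_morph -mulrA; congr (_ * _).
  by rewrite mulrC lapmC.
under eq_bigr => w _ do rewrite mulrCA mulrBr ![D w * _]mulrC.
by rewrite -mulr_sumr sumrB !sum_eq_mul mulrC.
Qed.

End PadicLaplacian.

(** * The lower p-series of a uniform group *)

Section UniformTower.
Local Open Scope classical_set_scope.
Local Open Scope group_scope.
Variables (p l : nat) (G : profiniteGroupType) (uG : uniform_pro_p p l G).

Lemma piq_surj (U : openNormal G) (a : quotg U) : exists x, piq U x = a.
Proof. by exists (generic_quotient.repr a); exact: generic_quotient.reprK. Qed.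

Lemma piqX (U : openNormal G) (x : G) n : piq U (x ^+ n) = piq U x ^+ n.
Proof.
elim: n => [|n IHn]; last by rewrite !expgS piqM IHn.
by rewrite !expg0; apply/esym/quotg_pi1.
Qed.

Lemma piq_eq1 (U : openNormal G) (x : G) : piq U x = 1 <-> U x.
Proof.
have -> : (1 : quotg U) = piq U 1 by exact: quotg_pi1.
split=> [/esym/eqP/quotgP|Ux]; first by rewrite invg1 mul1g.
by apply/esym/eqP/quotgP; rewrite invg1 mul1g.
Qed.

Lemma openNormal_closed (U : openNormal G) : closed (U : set G).
Proof.
rewrite -[X in closed X]setCK; apply: open_closedC.
rewrite (_ : ~` _ = \bigcup_(a in [set a : quotg U | a <> 1]) [set x | piq U x = a]).
  by apply: bigcup_open => a _; exact: piq_fiber_open.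
apply/seteqP; split=> [x /= nUx|x [a /= a1 /= xa] /piq_eq1 x1].
  by exists (piq U x) => //= /piq_eq1.
by apply: a1; rewrite -xa.
Qed.

(** If G/U has order p^k, then [U] contains all p^k-th powers and, being closed, the closed subgroup
    they generate. *)
Lemma Gn_cofinal (U : openNormal G) : exists n, on_le U (Gn uG n).
Proof.
have [k cardU] := uniform_index uG U; exists k => y Gy.
apply: (Gy U); [exact: onset_subgroup|exact: openNormal_closed|].
move=> _ [x _ <-]; apply/piq_eq1; rewrite piqX -cardU -cardsT.
exact: (@expg_cardG _ [set: quotg U]%G _ (finset.in_setT (piq U x))).
Qed.

Lemma quotmap_comp (U V W : openNormal G) (a : quotg U) :
  on_le V U -> on_le W V -> quotmap W (quotmap V a) = quotmap W a.
Proof.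
move=> VU WV; have WU : on_le W U by move=> y /VU /WV.
by have [x <-] := piq_surj a; rewrite !quotmap_pi.
Qed.

(** All fibres are translates of the kernel. Its order divides a power of p, and it exceeds 1
    because G_n / G_(n+1) is a nonzero vector space. *)
Lemma dvdp_quotmap_fiber (n : nat) (g : quotg (Gn uG n)) : 0 < l ->
  p %| #|[pred h : quotg (Gn uG n.+1) | quotmap (Gn uG n) h == g]|.
Proof.
move=> l0; set f := quotmap (U := Gn uG n.+1) (Gn uG n).
have sub : on_le (Gn uG n) (Gn uG n.+1) by apply: powgS.
have fM : forall a b, f (a * b) = f a * f b := quotmapM sub.
have fpi x : f (piq _ x) = piq _ x by exact: quotmap_pi.
have p_pr := uniform_prime uG.
have card_fiber a : #|[pred h | f h == a]| = #|[pred h | f h == 1]|.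
  have [x <-] := piq_surj a; rewrite -!sum1_card -fpi; set c := piq _ _.
  rewrite (reindex (fun h => c * h)) /=; last first.
    by apply: onW_bij; exists (fun h => c^-1 * h) => h; rewrite ?mulKg ?mulKVg.
  apply: eq_bigl => h; rewrite !inE fM -[X in _ == X]mulg1.
  exact: (inj_eq (mulgI (f c))).
rewrite card_fiber.
have [a cardA] := uniform_index uG (Gn uG n.+1).
have fiber_dvd : #|[pred h | f h == 1]| %| p ^ a.
  rewrite -cardA -[X in _ %| X]sum1_card (partition_big f predT) //=.
  rewrite (eq_bigr (fun=> #|[pred h | f h == 1]|)) => [|b _].
    by rewrite sum_nat_const dvdn_mull.
  by rewrite -(card_fiber b) -sum1_card.
have fiber_gt1 : 1 < #|[pred h | f h == 1]|.
  have [phi [phiM phiS phiK]] := uniform_quot uG n.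
  (* The all-ones vector is nonzero since [l] is positive. *)
  have [x Gx phix] := phiS (const_mx 1%R).
  have nGx : ~ powg G p n.+1 x.
    move=> /phiK -/(_ Gx); rewrite phix => /matrixP /(_ 0%R (Ordinal l0)).
    by rewrite !mxE => /eqP; rewrite GRing.oner_eq0.
  apply/card_gt1P; exists 1, (piq (Gn uG n.+1) x); rewrite !inE fpi.
  split; last by apply/eqP => /esym/piq_eq1.
    by rewrite -(inj_eq (mulgI (f 1))) -fM !mulg1.
  by apply/eqP/piq_eq1.
have /(dvdn_pfactor _ _ p_pr)[[|k] _ E] := fiber_dvd; rewrite E in fiber_gt1 *.
  by rewrite expn0 in fiber_gt1.
by rewrite expnS dvdn_mulr.
Qed.

End UniformTower.
(** * Free modules over the Iwasawa algebra as limits *)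

Section Levels.
Local Open Scope ring_scope.
Variables (p : nat) (G : profiniteGroupType) (T : finType).
Local Notation Z := (padic p)^o.
Local Notation F := {ffun T -> (Lambda p G)^o}.

(** For T = [vert X] this is convertible to [Div] of the derived graph, for T = [edge X] to its
    1-chains; one theory of limits serves both. *)
Definition level (U : openNormal G) : lmodType (padic p) :=
  {ffun T * quotg U -> Z}.

Definition level_map (V U : openNormal G) (x : T * quotg U) : T * quotg V :=
  (x.1, quotmap V x.2).

Definition level_push (V U : openNormal G) : {linear level U -> level V} :=
  fpush (@level_map V U).
Arguments level_push V {U}.

Definition level_transl (U : openNormal G) (h : quotg U) : {linear level U -> level U} :=
  fpush (fun x : T * quotg U => (x.1, (h * x.2)%g)).

Lemma level_push_comp (U V W : openNormal G) (a : level U) :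
  on_le V U -> on_le W V ->
  level_push W (level_push V a) = level_push W a.
Proof.
move=> VU WV; rewrite /level_push /= fpush_comp; apply: eq_fpush => -[t g].
by rewrite /level_map /= quotmap_comp.
Qed.

Lemma level_push_id (U : openNormal G) (a : level U) : level_push U a = a.
Proof.
rewrite -[RHS]fpush_id; apply: eq_fpush => -[t g].
by rewrite /level_map /=; have [x <-] := piq_surj g; rewrite quotmap_pi.
Qed.

Lemma level_pushE (U V : openNormal G) (a : level U) t g :
  level_push V a (t, g) = galg_map (quotmap V) [ffun h => a (t, h)] g.
Proof.
rewrite !ffunE; under [RHS]eq_bigr => h _ do rewrite ffunE.
rewrite [RHS](reindex_onto (fun x : T * quotg U => x.2) (fun h => (t, h))) //=.
apply: eq_big => [[t' h]|[t' h]] /=.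
  by rewrite /level_map /= !xpair_eqE eqxx andbT [RHS]andbC (eq_sym t).
by rewrite /level_map xpair_eqE /= => /andP[/eqP -> _].
Qed.

Lemma level_translE (U : openNormal G) (h : quotg U) (a : level U) t g :
  level_transl h a (t, g) = a (t, (h^-1 * g)%g).
Proof.
rewrite ffunE (big_pred1 (t, (h^-1 * g)%g)) // => -[t' g'] /=.
by rewrite !xpair_eqE -(inj_eq (mulgI h^-1%g)) mulKg.
Qed.

Definition to_level (U : openNormal G) (a : F) : level U :=
  [ffun x => limr (a x.1) U x.2].

Fact to_level_is_zmod_morphism U : zmod_morphism (@to_level U).
Proof. by move=> a b; apply/ffunP => x; rewrite !ffunE. Qed.
HB.instance Definition _ U :=
  GRing.isZmodMorphism.Build _ _ (@to_level U) (@to_level_is_zmod_morphism U).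

Lemma to_levelZ U (c : Lambda p G) (a : F) :
  to_level U (c *: a) = \sum_h (limr c U h : padic p) *: level_transl h (to_level U a).
Proof.
apply/ffunP => -[t g]; rewrite sum_ffunE !ffunE /=.
by apply: eq_bigr => h _; rewrite [RHS]ffunE level_translE ffunE.
Qed.

Lemma level_push_to_level V U (a : F) : on_le V U ->
  level_push V (to_level U a) = to_level V a.
Proof.
move=> VU; apply/ffunP => -[t g]; rewrite level_pushE [RHS]ffunE /=.
rewrite -(limrP (a t) VU); congr (galg_map _ _ g).
by apply/ffunP => h; rewrite !ffunE.
Qed.

Variables (l : nat) (uG : uniform_pro_p p l G).

Lemma to_level_inj (a b : F) :
  (forall n, to_level (Gn uG n) a = to_level (Gn uG n) b) -> a = b.
Proof.
move=> ab; apply/ffunP => t; apply: limr_inj => U.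
have [n Un] := Gn_cofinal uG U.
rewrite -(limrP (a t) Un) -(limrP (b t) Un); congr (galg_map _ _).
apply/ffunP => g; have /ffunP /(_ (t, g)) := ab n.
by rewrite !ffunE.
Qed.

(** [Lambda] is a limit over all open normal subgroups, the data only over the G_n. By cofinality
    the component at [U] is pushed down from any G_n inside [U], and [AE] shows that the choice of n
    does not matter. *)
Lemma to_level_surj (D : forall n, level (Gn uG n)) :
  (forall n, level_push (Gn uG n) (D n.+1) = D n) ->
  exists a : F, forall n, to_level (Gn uG n) a = D n.
Proof.
move=> compat1.
have compat m n : (m <= n)%N -> level_push (Gn uG m) (D n) = D m.
  elim: n => [|n IHn].
    by rewrite leqn0 => /eqP ->; exact: level_push_id.
  rewrite leq_eqVlt => /orP[/eqP ->|mn]; first exact: level_push_id.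
  rewrite -(IHn mn) -(compat1 n) level_push_comp //; exact: powgS.
have [k kP] := choice (Gn_cofinal uG).
pose E n t : galg (padic p) (quotg (Gn uG n)) := [ffun h => D n (t, h)].
pose A t U : galg (padic p) (quotg U) := galg_map (quotmap U) (E (k U) t).
have AE t U n : on_le U (Gn uG n) -> A t U = galg_map (quotmap U) (E n t).
  have step m n' : (m <= n')%N -> on_le U (Gn uG m) ->
      galg_map (quotmap U) (E n' t) = galg_map (quotmap U) (E m t).
    move=> mn Um; have -> : E m t = galg_map (quotmap _) (E n' t).
      by apply/ffunP => h; rewrite ffunE -(compat _ _ mn) level_pushE.
    rewrite /galg_map fpush_comp; apply: eq_fpush => h /=.
    by rewrite quotmap_comp //; exact: powgS.
  move=> Un; rewrite /A; case: (leqP (k U) n) => [kn|/ltnW nk].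
    by rewrite (step (k U) n).
  by rewrite (step n (k U)).
have A_compat t V U (VU : on_le V U) : Lambda_tr p VU (A t U) = A t V.
  have UkU := kP U; rewrite (AE t V (k U)); last by move=> y /UkU /VU.
  rewrite /A /= /galg_map fpush_comp; apply: eq_fpush => h /=.
  by rewrite quotmap_comp.
exists [ffun t => LimRing (A_compat t) : (Lambda p G)^o] => n.
apply/ffunP => -[t g]; transitivity (A t (Gn uG n) g); first by rewrite !ffunE.
rewrite (AE t _ n) //.
by rewrite -level_pushE compat.
Qed.

(** Turns an arbitrary sequence of level elements into a compatible system. For small N the
    pushforward is meaningless, [quotmap] being a total function, but the ultralimit ignores these
    terms. *)
Lemma level_ulim_compat (s : forall N, level (Gn uG N)) n :
  level_push (Gn uG n) (ulim_fun (fun N => level_push (Gn uG n.+1) (s N)))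
  = ulim_fun (fun N => level_push (Gn uG n) (s N)).
Proof.
etransitivity; first exact: fpush_ulim_fun.
apply: (eq_ulim_fun (n := n.+1)) => N nN.
by apply: level_push_comp; exact: powgS.
Qed.

End Levels.
Arguments level_push {p G T} V {U}.
Arguments level_transl {p G T U} h.

(** * Divisors of the derived graphs *)

Section Boundary.
Local Open Scope ring_scope.
Variable p : nat.

Lemma sum_fpush_scale (S T : finType) (V : lmodType (padic p)) (f : S -> T)
    (c : {ffun S -> (padic p)^o}) (E : T -> V) :
  \sum_t (fpush f c t : padic p) *: E t = \sum_s (c s : padic p) *: E (f s).
Proof.
rewrite [RHS](partition_big f predT) //=; apply: eq_bigr => t _.
by rewrite ffunE scaler_suml; apply: eq_bigr => s /eqP ->.
Qed.

Lemma fpush_lap (Y Z : graph) (c : covmap p Y Z) (D : Div p Y) :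
  fpush c (lap D) = lap (fpush c D).
Proof.
rewrite /lap sum_fpush_scale linear_sum; apply: eq_bigr => y _.
by rewrite linearZ /= covP.
Qed.

Variable Y : graph.

Definition bdry (c : {ffun edge Y -> (padic p)^o}) : Div p Y :=
  \sum_e (c e : padic p) *: (dirac p (src e) - dirac p (tgt e)).

Fact bdry_is_linear : linear bdry.
Proof.
move=> a c d; rewrite /bdry scaler_sumr -big_split; apply: eq_bigr => e _ /=.
by rewrite !ffunE scalerDl scalerA.
Qed.
HB.instance Definition _ := GRing.isLinear.Build _ _ _ _ bdry bdry_is_linear.

Lemma sum_dirac (y : vert Y) : \sum_v dirac p y v = 1.
Proof.
rewrite (bigD1 y) //= ffunE eqxx big1 ?addr0 // => v /negPf vy.
by rewrite ffunE vy.
Qed.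

Lemma bdry_Div0 c : bdry c \in Div0 p Y.
Proof.
apply: rpred_sum => e _; apply: rpredZ; rewrite -topredE /= /deg0p.
under eq_bigr => v _ do rewrite !ffunE.
have sum1 (y : vert Y) : \sum_v (v == y)%:R = 1 :> padic p.
  by rewrite -[RHS](sum_dirac y); apply: eq_bigr => v _; rewrite ffunE.
by rewrite sumrB !sum1 subrr.
Qed.

(** Whether v - y0 is a boundary does not change along an edge, so by connectedness it holds for
    every v; a divisor of degree zero is a combination of such differences. *)
Lemma bdry_surj (D : Div p Y) : connected_graph Y -> D \in Div0 p Y ->
  exists c, bdry c = D.
Proof.
move=> conY D0; have [[y0] _] := conY.
pose f v := `[< exists c, bdry c = dirac p v - dirac p y0 >].
have bdry1 e : exists c, bdry c = dirac p (src e) - dirac p (tgt e).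
  exists [ffun e' => (e' == e)%:R].
  rewrite /bdry (bigD1 e) //= ffunE eqxx scale1r big1 ?addr0 // => e' /negPf ee'.
  by rewrite ffunE ee' scale0r.
have f1 v : f v.
  have -> : f v = f y0.
    apply: (connected_const conY) => e; have [c hc] := bdry1 e.
    apply/asboolP/asboolP => -[d hd]; [exists (d - c)|exists (d + c)].
      by rewrite linearB /= hc hd opprB addrC addrA subrK.
    by rewrite linearD /= hc hd addrC addrA subrK.
  by apply/asboolP; exists 0; rewrite linear0 subrr.
have [b bE] := choice (fun v => asboolP _ (f1 v)).
exists (\sum_v (D v : padic p) *: b v); rewrite linear_sum.
under eq_bigr => v _ do rewrite linearZ /= bE scalerBr.
rewrite sumrB -scaler_suml; move: D0; rewrite -topredE /= /deg0p => /eqP ->.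
rewrite scale0r subr0; apply/ffunP => v; rewrite sum_ffunE.
rewrite -[RHS](sum_eq_mul D v); apply: eq_bigr => w _.
by rewrite !ffunE eq_sym [RHS]mulrC.
Qed.

End Boundary.

Lemma fpush_bdry p (Y Z : graph) (f : vert Y -> vert Z) (fe : edge Y -> edge Z)
    (c : {ffun edge Y -> ((padic p)^o)%R}) :
  (forall e, src (fe e) = f (src e)) -> (forall e, tgt (fe e) = f (tgt e)) ->
  fpush f (bdry c) = bdry (fpush fe c).
Proof.
move=> fs ft; rewrite /bdry sum_fpush_scale linear_sum; apply: eq_bigr => e _.
by rewrite linearZ linearB /= !fpush_dirac fs ft.
Qed.

(** * The Laplacian on the free Iwasawa module *)

Section IwasawaLaplacian.
Local Open Scope ring_scope.
Variables (p l : nat) (G : profiniteGroupType) (uG : uniform_pro_p p l G).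
Variables (X : graph) (alpha : edge X -> G).
Local Notation F := {ffun vert X -> (Lambda p G)^o}.
Local Notation Y U := (derivedU alpha U).

Definition divU U (a : F) : Div p (Y U) := to_level U a.

Lemma fpush_derivedU V U (VU : on_le V U) (D : Div p (Y U)) :
  fpush (derivedU_map p alpha VU) D = level_push V (D : level p (vert X) U).
Proof. by apply: eq_fpush => -[v g]; rewrite /= /derived_fun mul1g. Qed.

Lemma level_push_lap V U (VU : on_le V U) (D : Div p (Y U)) :
  level_push V (lap D : level p (vert X) U)
  = lap (level_push V (D : level p (vert X) U) : Div p (Y V)).
Proof. by rewrite -!(fpush_derivedU VU) fpush_lap. Qed.

Lemma divUZ U c (a : F) :
  divU U (c *: a) = \sum_h (limr c U h : padic p) *: fpush (transl p _ h) (divU U a).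
Proof. exact: to_levelZ. Qed.

Lemma lapF_exists (y : F) :
  exists a : F, forall n, divU (Gn uG n) a = lap (divU (Gn uG n) y).
Proof.
apply: (to_level_surj (D := fun n => lap (divU (Gn uG n) y))) => n.
have sub : on_le (Gn uG n) (Gn uG n.+1) by apply: powgS.
by rewrite (level_push_lap sub) /divU level_push_to_level.
Qed.

Definition lapF (y : F) : F := sval (cid (lapF_exists y)).

Lemma lapFE n (y : F) : divU (Gn uG n) (lapF y) = lap (divU (Gn uG n) y).
Proof. exact: (svalP (cid (lapF_exists y))). Qed.

(** Left translations are automorphisms of the derived graphs, so they commute with [lap] at each
    level. *)
Fact lapF_is_linear : linear lapF.
Proof.
move=> c x y; apply: (to_level_inj (uG := uG)) => n.
have divUD a b : divU (Gn uG n) (a + b) = divU (Gn uG n) a + divU (Gn uG n) b.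
  exact: (raddfD (@to_level p G (vert X) (Gn uG n))).
rewrite -![to_level _ _]/(divU _ _) divUD divUZ !lapFE divUD divUZ linearD linear_sum.
congr (_ + _); apply: eq_bigr => h _; rewrite linearZ /=; congr (_ *: _).
exact: (esym (fpush_lap (transl p (fun e => piq (Gn uG n) (alpha e)) h) _)).
Qed.
HB.instance Definition _ := GRing.isLinear.Build _ _ _ _ lapF lapF_is_linear.

Hypothesis Xn_connected : forall n : nat, connected_graph (Xn alpha uG n).

Lemma lapF_inj (l0 : (0 < l)%N) y : lapF y = 0 -> y = 0.
Proof.
move=> y0; have p_pr := uniform_prime uG.
have const n u v : divU (Gn uG n) y u = divU (Gn uG n) y v.
  apply: (lap_ker p_pr (Xn_connected n)); rewrite -lapFE y0.
  exact: (raddf0 (@to_level p G (vert X) (Gn uG n))).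
(* The value at level n sums the constant value at level n+1 over a fibre, whose size is divisible
   by p. *)
have down n u v : exists m : nat,
    divU (Gn uG n) y u = divU (Gn uG n.+1) y v * (m * p)%:R.
  have sub : on_le (Gn uG n) (Gn uG n.+1) by apply: powgS.
  have /dvdnP[m hm] := dvdp_quotmap_fiber u.2 l0; exists m.
  rewrite -hm {1}/divU -(level_push_to_level _ sub) [u]surjective_pairing level_pushE ffunE.
  rewrite (eq_bigr (fun=> divU (Gn uG n.+1) y v)) ?sumr_const ?mulr_natr //.
  by move=> h _; rewrite ffunE; exact: const.
(* Climbing [k] levels makes the value divisible by p^k, for every [k]; the vertex over 1 is an
   arbitrary choice. *)
have div_pk k n u : exists d, divU (Gn uG n) y u = d * (p ^ k)%:R.
  elim: k n u => [|k IHk] n u; first by eexists; rewrite expn0 mulr1.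
  have [m ->] := down n u (u.1, 1%g).
  have [d ->] := IHk n.+1 (u.1, 1%g).
  by exists (d * m%:R); rewrite expnS !natrM -!mulrA; congr (_ * _); rewrite mulrC mulrA.
apply: (to_level_inj (uG := uG)) => n; apply/ffunP => u.
rewrite raddf0 [RHS]ffunE; apply: limr_inj => k.
by have [d ->] := div_pk k.+1 n u; rewrite padic_expn_eq0.
Qed.

(** [Pr] is stable under ultralimits: preimages under [lap] are chosen for each N, and their
    ultralimit is a preimage of the limit. *)
Lemma ulim_mod_Pr (s : forall N, Div p (Xn alpha uG N)) n :
  (forall N, (n <= N)%N ->
     level_push (Gn uG n) (s N : level p (vert X) _) - s n \in Pr p (Xn alpha uG n)) ->
  ulim_fun (fun N => level_push (Gn uG n) (s N : level p (vert X) (Gn uG N))) - s n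
    \in Pr p (Xn alpha uG n).
Proof.
move=> hs; have hz N : exists z : Div p (Xn alpha uG n), (n <= N)%N ->
    level_push (Gn uG n) (s N : level p (vert X) (Gn uG N)) = lap z + s n.
  (* The value 0 for N < n is a placeholder that the ultralimit does not see. *)
  have [nN|] := leqP n N; last by exists 0.
  have /mem_PrP[z hz] := hs N nN.
  by exists z => _; rewrite hz subrK.
have [z zE] := choice hz.
rewrite (eq_ulim_fun zE) ulim_funD ulim_fun_cst addrK.
by apply/mem_PrP; exists (ulim_fun z); rewrite /lap ulim_fun_lincomb.
Qed.

(* Compactness of the [Div (X_n)], in the form of an ultralimit of solutions. *)
Lemma lapF_image (x : F) :
  (forall n, divU (Gn uG n) x \in Pr p (Xn alpha uG n)) -> exists y, lapF y = x.
Proof.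
move=> xPr; have hs N : exists s : Div p (Xn alpha uG N), lap s = divU (Gn uG N) x.
  by apply/mem_PrP; exact: xPr.
pose s N : level p (vert X) (Gn uG N) := sval (cid (hs N)).
have [y yE] := to_level_surj (level_ulim_compat s).
exists y; apply: (to_level_inj (uG := uG)) => n.
rewrite -![to_level _ _]/(divU _ _) lapFE /divU yE /lap ulim_fun_lincomb.
rewrite -[RHS]ulim_fun_cst; apply: (eq_ulim_fun (n := n)) => N nN.
have sub : on_le (Gn uG n) (Gn uG N) by exact: powgS.
rewrite -[LHS]/(lap (level_push (Gn uG n) (s N) : Div p (Y (Gn uG n)))).
by rewrite -(level_push_lap sub) (svalP (cid (hs N))) /divU level_push_to_level.
Qed.

End IwasawaLaplacian.
(** * The limits of Pic and J *)

Lemma fin_gen_of_free (R : pzRingType) (T : finType) (M : lmodType R)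
    (f : {linear {ffun T -> (R^o)%R} -> M}) :
  (forall m, exists x, f x = m) -> fin_gen M.
Proof.
move=> f_surj.
exists #|T|, (fun i => f [ffun t => (t == enum_val i)%:R%R]) => m.
have [x <-] := f_surj m; exists (fun i => x (enum_val i)).
under eq_bigr => i _ do rewrite -linearZ.
rewrite -linear_sum; congr (f _); apply/ffunP => t; rewrite sum_ffunE.
rewrite (bigD1 (enum_rank t)) //= big1 => [|i it].
  by rewrite !ffunE enum_rankK eqxx [(_ *: _)%R]mulr1 addr0.
rewrite !ffunE (_ : _ == _ = false) ?[(_ *: _)%R]mulr0 //.
by apply: contraNF it => /eqP ->; rewrite enum_valK.
Qed.

Section PicardLimits.
Local Open Scope ring_scope.
Variables (p l : nat) (G : profiniteGroupType) (uG : uniform_pro_p p l G).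
Variables (X : graph) (alpha : edge X -> G).
Local Notation F := {ffun vert X -> (Lambda p G)^o}.
Local Notation E := {ffun edge X -> (Lambda p G)^o}.
Local Notation Y n := (Xn alpha uG n).

Lemma PicU_trE V U (VU : on_le V U) (D : Div p (derivedU alpha U)) :
  PicU_tr p alpha VU (piN (Pr p (derivedU alpha U)) D)
  = piN (Pr p (derivedU alpha V)) (level_push V (D : level p (vert X) U)).
Proof.
rewrite -(fpush_derivedU VU).
exact: (quotmod_map_pi (@fpush_Pr p _ _ (derivedU_map p alpha VU))).
Qed.

Lemma PicUZ U (c : Lambda p G) (D : Div p (derivedU alpha U)) :
  c *: (piN (Pr p (derivedU alpha U)) D : PicU p alpha U)
  = piN (Pr p (derivedU alpha U))
      (\sum_h (limr c U h : padic p) *: fpush (transl p _ h) D).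
Proof.
rewrite linear_sum; apply: eq_bigr => h _; rewrite linearZ /=; congr (_ *: _).
exact: (quotmod_map_pi (@fpush_Pr p _ _ (transl p _ h))).
Qed.

Fact picF_compat (y : F) m n (mn : (m <= n)%N) :
  PicU_tr p alpha (Gn_le (uG:=uG) mn) (piN (Pr p (Y n)) (divU alpha (Gn uG n) y))
  = piN (Pr p (Y m)) (divU alpha (Gn uG m) y).
Proof. by rewrite PicU_trE /divU level_push_to_level //; exact: powgS. Qed.

Definition picF (y : F) : Pic_inf alpha uG :=
  LimMod (tr := fun m n (mn : (m <= n)%N) => PicU_tr p alpha (Gn_le (uG:=uG) mn))
    (picF_compat y).

Fact picF_is_linear : linear picF.
Proof.
move=> c x y; apply: limm_inj => n.
rewrite -[RHS]/(c *: (piN (Pr p (Y n)) (divU alpha (Gn uG n) x) : PicU p alpha _)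
  + piN (Pr p (Y n)) (divU alpha (Gn uG n) y)).
rewrite PicUZ -divUZ -[LHS]/(piN (Pr p (Y n)) (divU alpha (Gn uG n) (c *: x + y))).
by rewrite -raddfD /divU -raddfD.
Qed.
HB.instance Definition _ := GRing.isLinear.Build _ _ _ _ picF picF_is_linear.

Lemma picF_ker (x : F) : picF x = 0 <-> exists y, lapF uG alpha y = x.
Proof.
split=> [x0|[y <-]].
  apply: lapF_image => n; rewrite -[X in X \in _]subr0 -piN_eq linear0.
  by apply/eqP; have /(congr1 (fun z : Pic_inf alpha uG => limm z n)) := x0.
apply: limm_inj => n; apply/eqP.
rewrite -[limm 0 n]/(0 : quotmod (Pr p (Y n))) -(linear0 (piN (Pr p (Y n)))).
rewrite -[limm _ n]/(piN (Pr p (Y n)) (divU alpha (Gn uG n) (lapF uG alpha y))).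
by rewrite piN_eq subr0; apply/mem_PrP; eexists; rewrite lapFE.
Qed.

(** Representatives chosen at each level need not be compatible. The ultralimits of their
    pushforwards are, and they represent the same classes by [ulim_mod_Pr]. *)
Lemma picF_surj (x : Pic_inf alpha uG) : exists y, picF y = x.
Proof.
pose s N : level p (vert X) (Gn uG N) := reprN (limm x N : quotmod (Pr p (Y N))).
have [y yE] := to_level_surj (level_ulim_compat s).
exists y; apply: limm_inj => n.
rewrite -[limm x n](reprNK (limm x n : quotmod (Pr p (Y n)))).
apply/eqP; rewrite [_ == _]piN_eq /divU yE; apply: (ulim_mod_Pr (s := s)) => N nN.
rewrite -piN_eq -(PicU_trE (Gn_le (uG:=uG) nN)) !reprNK; apply/eqP.
exact: (limmP x nN).
Qed.

Fact J_to_Pic_sub (Z : graph) (D : submod (Div0 p Z)) :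
  D \in Pr0 p Z -> val D \in Pr p Z.
Proof. by []. Qed.

Definition J_to_Pic (Z : graph) : J p Z -> Pic p Z :=
  quotmod_map (N := Pr0 p Z) (Pr p Z) (val : {linear submod (Div0 p Z) -> Div p Z}).

Lemma J_to_Pic_pi (Z : graph) (D : submod (Div0 p Z)) :
  J_to_Pic (piN (Pr0 p Z) D) = piN (Pr p Z) (val D).
Proof. exact: (quotmod_map_pi (@J_to_Pic_sub Z)). Qed.

Fact J_to_Pic_is_linear (Z : graph) : linear (@J_to_Pic Z).
Proof. exact: (quotmod_map_is_linear (@J_to_Pic_sub Z)). Qed.
HB.instance Definition _ (Z : graph) :=
  GRing.isLinear.Build _ _ _ _ (@J_to_Pic Z) (@J_to_Pic_is_linear Z).

Lemma J_to_Pic_map (Z1 Z2 : graph) (c : covmap p Z1 Z2) (x : J p Z1) :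
  J_to_Pic (J_map c x) = Pic_map c (J_to_Pic x).
Proof.
rewrite -(reprNK x) J_to_Pic_pi [Pic_map c _](quotmod_map_pi (@fpush_Pr p _ _ c)).
by rewrite [J_map c _](quotmod_map_pi (@Div0_push_Pr0 p _ _ c)) J_to_Pic_pi.
Qed.

Lemma J_to_Pic_inj (Z : graph) (x : J p Z) : J_to_Pic x = 0 -> x = 0.
Proof.
rewrite -(reprNK x) J_to_Pic_pi => /eqP.
rewrite -(linear0 (piN (Pr p Z))) piN_eq subr0 => h.
by apply/eqP; rewrite -(linear0 (piN (Pr0 p Z))) piN_eq subr0.
Qed.

Fact J_inf_to_Pic_compat (x : J_inf alpha uG) m n (mn : (m <= n)%N) :
  PicU_tr p alpha (Gn_le (uG:=uG) mn) (J_to_Pic (limm x n : J p (Y n)))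
  = J_to_Pic (limm x m : J p (Y m)).
Proof.
rewrite -(limmP x mn).
exact: (esym (J_to_Pic_map (derivedU_map p alpha (Gn_le (uG:=uG) mn)) _)).
Qed.

Definition J_inf_to_Pic (x : J_inf alpha uG) : Pic_inf alpha uG :=
  LimMod (tr := fun m n (mn : (m <= n)%N) => PicU_tr p alpha (Gn_le (uG:=uG) mn))
    (J_inf_to_Pic_compat x).

Fact J_inf_to_Pic_is_linear : linear J_inf_to_Pic.
Proof.
move=> c x y; apply: limm_inj => n.
transitivity (J_to_Pic (\sum_h (limr c (Gn uG n) h : padic p) *:
    J_act p _ h (limm x n : J p (Y n)) + (limm y n : J p (Y n)))) => //.
rewrite linearD linear_sum /=; congr (_ + _); apply: eq_bigr => h _.
rewrite linearZ /=; congr (_ *: _); exact: J_to_Pic_map.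
Qed.
HB.instance Definition _ :=
  GRing.isLinear.Build _ _ _ _ J_inf_to_Pic J_inf_to_Pic_is_linear.

Lemma J_inf_to_Pic_inj (x : J_inf alpha uG) : J_inf_to_Pic x = 0 -> x = 0.
Proof.
move=> x0; apply: limm_inj => n; apply: J_to_Pic_inj.
by have /(congr1 (fun z : Pic_inf alpha uG => limm z n)) := x0.
Qed.

Definition bdry0 (Z : graph) (c : {ffun edge Z -> (padic p)^o}) : submod (Div0 p Z) :=
  Sub (bdry c) (bdry_Div0 c).

Definition bdryU U (c : E) : submod (Div0 p (derivedU alpha U)) :=
  bdry0 (to_level U c : {ffun edge (derivedU alpha U) -> (padic p)^o}).

Lemma level_push_bdry V U (VU : on_le V U)
    (c : {ffun edge (derivedU alpha U) -> (padic p)^o}) :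
  fpush (derivedU_map p alpha VU) (bdry c)
  = bdry (level_push V (c : level p (edge X) U)
          : {ffun edge (derivedU alpha V) -> (padic p)^o}).
Proof.
apply: (@fpush_bdry p (derivedU alpha U) (derivedU alpha V) (derivedU_map p alpha VU)
  (@level_map G (edge X) V U)) => -[e g]; rewrite /= /derived_fun /= mul1g //.
by rewrite (quotmapM VU) quotmap_pi.
Qed.

Lemma transl_bdry U (h : quotg U)
    (c : {ffun edge (derivedU alpha U) -> (padic p)^o}) :
  fpush (transl p (fun e => piq U (alpha e)) h) (bdry c)
  = bdry (level_transl h (c : level p (edge X) U)
          : {ffun edge (derivedU alpha U) -> (padic p)^o}).
Proof.
apply: (@fpush_bdry p (derivedU alpha U) (derivedU alpha U) (transl p _ h)
  (fun x : edge X * quotg U => (x.1, (h * x.2)%g))) => -[e g] //.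
by rewrite /= /derived_fun /= mulgA.
Qed.

Fact jF_compat (c : E) m n (mn : (m <= n)%N) :
  JU_tr p alpha (Gn_le (uG:=uG) mn) (piN (Pr0 p (Y n)) (bdryU (Gn uG n) c))
  = piN (Pr0 p (Y m)) (bdryU (Gn uG m) c).
Proof.
rewrite [LHS](quotmod_map_pi
  (@Div0_push_Pr0 p _ _ (derivedU_map p alpha (Gn_le (uG:=uG) mn)))).
congr piN; apply: val_inj; rewrite [RHS]/=.
rewrite -(level_push_to_level c (Gn_le (uG:=uG) mn)).
exact: level_push_bdry.
Qed.

Definition jF (c : E) : J_inf alpha uG :=
  LimMod (tr := fun m n (mn : (m <= n)%N) => JU_tr p alpha (Gn_le (uG:=uG) mn))
    (jF_compat c).

(** Left translations carry edges to edges, so they commute with the boundary. *)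
Fact jF_is_linear : linear jF.
Proof.
move=> c x y; apply: limm_inj => n.
transitivity (\sum_h (limr c (Gn uG n) h : padic p) *:
    J_act p _ h (piN (Pr0 p (Y n)) (bdryU (Gn uG n) x))
  + piN (Pr0 p (Y n)) (bdryU (Gn uG n) y)) => //.
rewrite (eq_bigr (fun h => piN (Pr0 p (Y n)) ((limr c (Gn uG n) h : padic p) *:
    Div0_push (transl p (fun e => piq (Gn uG n) (alpha e)) h) (bdryU (Gn uG n) x)))).
  rewrite -linear_sum -linearD; congr piN; apply: val_inj.
  transitivity (bdry (to_level (Gn uG n) (c *: x) + to_level (Gn uG n) y
      : {ffun edge (Y n) -> (padic p)^o})); first by rewrite -raddfD.
  rewrite to_levelZ [RHS]linearD [LHS]linearD !linear_sum.
  congr (_ + _); apply: eq_bigr => h _; rewrite !linearZ /=; congr (_ *: _).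
  exact/esym/transl_bdry.
move=> h _; rewrite linearZ /=; congr (_ *: _).
exact: (quotmod_map_pi (@Div0_push_Pr0 p _ _ (transl p _ h))).
Qed.
HB.instance Definition _ := GRing.isLinear.Build _ _ _ _ jF jF_is_linear.

Hypothesis Xn_connected : forall n : nat, connected_graph (Xn alpha uG n).

(** The argument for [picF_surj], with chains bounding the representatives in place of the
    representatives themselves. As [Pr0] is the preimage of [Pr], classes are compared in [Pic]. *)
Lemma jF_surj (x : J_inf alpha uG) : exists c, jF c = x.
Proof.
pose s N : Div p (Y N) := val (reprN (limm x N : quotmod (Pr0 p (Y N)))).
have hc N : exists c : {ffun edge (Y N) -> (padic p)^o}, bdry c = s N.
  by apply: bdry_surj => //; exact: valP.
pose c N : level p (edge X) (Gn uG N) := sval (cid (hc N)).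
have [a aE] := to_level_surj (level_ulim_compat c).
exists a; apply: limm_inj => n.
rewrite -[limm x n](reprNK (limm x n : quotmod (Pr0 p (Y n)))).
apply/eqP; rewrite [_ == _]piN_eq -topredE /= /preimp linearB /=.
rewrite aE /bdry ulim_fun_lincomb.
have -> : ulim_fun (fun N => bdry (level_push (Gn uG n) (c N)
      : {ffun edge (Y n) -> (padic p)^o}))
    = ulim_fun (fun N => level_push (Gn uG n) (s N : level p (vert X) (Gn uG N))).
  apply: (eq_ulim_fun (n := n)) => N nN.
  rewrite -(level_push_bdry (Gn_le (uG:=uG) nN)) (svalP (cid (hc N))).
  exact: fpush_derivedU.
apply: (ulim_mod_Pr (s := s)) => N nN.
rewrite -piN_eq -(PicU_trE (Gn_le (uG:=uG) nN)); apply/eqP.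
rewrite /s -!J_to_Pic_pi !reprNK; exact: J_inf_to_Pic_compat.
Qed.

End PicardLimits.

Theorem theorem3p11 (p l : nat) (l_gt0 : 0 < l)
    (G : profiniteGroupType) (uG : uniform_pro_p p l G)
    (Q : unitRingType) (iota : {rmorphism Lambda p G -> Q})
    (QG : is_fraction_skew_field iota)
    (X : graph) (X_connected : connected_graph X)
    (alpha : edge X -> G)
    (Xn_connected : forall n : nat, connected_graph (Xn alpha uG n)) :
  [/\ torsion iota (Pic_inf alpha uG),
      torsion iota (J_inf alpha uG),
      no_pseudo_null_submod iota (Pic_inf alpha uG)
    & no_pseudo_null_submod iota (J_inf alpha uG)].
Proof.
pose d := lapF uG alpha; pose f := picF uG alpha.
have d_inj := lapF_inj Xn_connected l_gt0.
have f_surj : forall m, exists x, f x = m := picF_surj (alpha := alpha).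
have Pic_tors (x : Pic_inf alpha uG) : exists2 s : Lambda p G, s != 0%R & (s *: x = 0)%R.
  have [y <-] := f_surj x.
  have [s [z [s0 sz]]] := injective_endo_torsion_coker QG d_inj y.
  by exists s => //; rewrite -linearZ /=; apply/picF_ker; exists z.
(* A submodule of a module that embeds into [Pic_inf] embeds there as well, so one argument covers
   both modules. *)
have no_sub (M : lmodType (Lambda p G)) (i : {linear M -> Pic_inf alpha uG}) :
    (forall x, i x = 0%R -> x = 0%R) -> no_pseudo_null_submod iota M.
  move=> i_inj N [_ extN] x Nx.
  pose j : {linear submod N -> Pic_inf alpha uG} := i \o (val : {linear submod N -> M}).
  have j_inj y : j y = 0%R -> y = 0%R.
    by move=> /i_inj y0; apply: val_inj; rewrite y0 linear0.
  have := ext1_zero_embed_coker QG d_inj f_surj (@picF_ker _ _ _ uG X alpha) j_inj extN.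
  by move=> /(_ (Sub x Nx)) /(congr1 val); rewrite SubK.
split.
- by apply: torsion_of_annihilated => //; apply: fin_gen_of_free f_surj.
- apply: torsion_of_annihilated => // [|x].
    exact: (fin_gen_of_free (jF_surj Xn_connected)).
  (* An annihilator of the image in [Pic_inf] annihilates the element itself, by injectivity. *)
  have [s s0 sx] := Pic_tors (J_inf_to_Pic x); exists s => //.
  by apply: J_inf_to_Pic_inj; rewrite linearZ.
- by apply: (no_sub _ idfun).
- exact: (no_sub _ (@J_inf_to_Pic _ _ _ uG X alpha) (@J_inf_to_Pic_inj _ _ _ uG X alpha)).
Qed.
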